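(* Let $f\in\mathrm{LC}$ satisfy: (H$_1$) there exist $\alpha,\beta\in L^1_{loc}$ with $\beta\ge0$ such that $2\langle f(t,x),x\rangle\le\alpha(t)|x|^2+\beta(t)$ for a.e. $(t,x)\in\mathbb R^{1+N}$; (H$_2$) there are $\alpha_1>0$ and $K\ge1$ with $\exp\big(\int_s^t\alpha(u)du\big)\le Ke^{-\alpha_1(t-s)}$ for $s\le t\le0$; (H$_3$) the set $\{\beta_t\mid t\in\mathbb R\}$, $\beta_t(s)=\beta(s+t)$, is $L^1_{loc}$-bounded, i.e. $\sup_{t\in\mathbb R}\int_{-r}^r\beta(s+t)ds<\infty$ for every $r>0$. Then the process $S_f$ is strongly pullback bounded dissipative on $(-\infty,\tau]$ for every $\tau\in\mathbb R$, and consequently it has a pullback attractor $\{\mathcal A(t)\}$ which is bounded in the past, i.e. $\bigcup_{t\le\tau}\mathcal A(t)$ is bounded for every $\tau$.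
   Context: $\mathrm{LC}$: Borel measurable $f:\mathbb R\times\mathbb R^N\to\mathbb R^N$ such that for every compact $K$ there are $m^K,l^K\in L^1_{loc}$ with $|f(t,x)|\le m^K(t)$ and $|f(t,x)-f(t,y)|\le l^K(t)|x-y|$ for $x,y\in K$, a.e. $t$. Under (H$_1$) all solutions of $\dot x=f(t,x)$, $x(r)=x_0$ exist on $[r,\infty)$, and the process is $S_f(t,r)x_0=x(t,f,r,x_0)$, $t\ge r$, the value at $t$ of that solution. A family $\{B(t)\}_{t\in\mathbb R}$ of nonempty bounded sets is pullback absorbing for $S$ if for every $t$ and bounded $D$ there is $T(t,D)>0$ with $S(t,t-s)D\subset B(t)$ for $s\ge T(t,D)$. $S$ is strongly pullback bounded dissipative on $(-\infty,\tau]$ if there is a pullback absorbing family $\{B(t)\}$ such that for each bounded $D$ there is $T(\tau,D)>0$ with $S(t,t-s)D\subset B(\tau)$ for all $t\le\tau$, $s\ge T(\tau,D)$. A pullback attractor of a process $S$ on $\mathbb R^N$ is a family $\{\mathcal A(t)\}_{t\in\mathbb R}$ of compact sets with $S(t,s)\mathcal A(s)=\mathcal A(t)$ for $t\ge s$, $\lim_{s\to-\infty}\mathrm{dist}(S(t,s)D,\mathcal A(t))=0$ for every bounded $D$ and $t$ (Hausdorff semi-distance), and minimal among closed families with this attraction property. *)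

(* Defs.v *)
From HB Require Import structures.
From mathcomp Require Import all_boot all_order all_algebra.
From mathcomp Require Import all_classical all_reals all_analysis.
Set Implicit Arguments. Unset Strict Implicit. Unset Printing Implicit Defensive.
Import Order.TTheory GRing.Theory Num.Theory.
Import numFieldNormedType.Exports.
Local Open Scope classical_set_scope.
Local Open Scope ring_scope.

Section Defs.
Context {R : realType} {N : nat}.
Local Notation V := 'rV[R]_N.
Local Notation mu := (@lebesgue_measure R).

Definition dotp (x y : V) : R := \sum_(i < N) x 0 i * y 0 i.
Definition enorm (x : V) : R := Num.sqrt (dotp x x).

Definition bdd_set (D : set V) := exists M : R, forall x, D x -> enorm x <= M.

Definition borel_RxV : set (set (R * V)) := smallest (sigma_algebra setT) open.
Definition borel_measurable_f (f : R -> V -> V) :=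
  forall B : set V, open B -> borel_RxV [set p : R * V | B (f p.1 p.2)].

(* Lebesgue-null subsets of R^{1+N} = R x R^N: coverable by countably many
   closed boxes of arbitrarily small total volume *)
Definition box (a b : R) (c d : V) : set (R * V) :=
  [set p : R * V | a <= p.1 <= b /\ forall i, c 0 i <= p.2 0 i <= d 0 i].
Definition boxvol (a b : R) (c d : V) : R :=
  Num.max 0 (b - a) * \prod_(i < N) Num.max 0 (d 0 i - c 0 i).
Definition null_RxV (Z : set (R * V)) :=
  forall e : R, 0 < e -> exists (a b : nat -> R) (c d : nat -> V),
    Z `<=` \bigcup_n box (a n) (b n) (c n) (d n) /\
    forall n, \sum_(k < n) boxvol (a k) (b k) (c k) (d k) < e.
Definition ae_RxV (P : R -> V -> Prop) :=
  exists Z, null_RxV Z /\ forall t x, ~ Z (t, x) -> P t x.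

Definition LC (f : R -> V -> V) :=
  borel_measurable_f f /\
  forall K : set V, compact K -> exists m l : R -> R,
    locally_integrable setT m /\ locally_integrable setT l /\
    {ae mu, forall t, forall x y, K x -> K y ->
        enorm (f t x) <= m t /\ enorm (f t x - f t y) <= l t * enorm (x - y)}.

(* Caratheodory solution of x' = f(t,x), x(r) = x0, on [r, T] (integral form) *)
Definition is_solution (f : R -> V -> V) (r : R) (x0 : V) (T : R) (x : R -> V) :=
  x r = x0 /\ forall i : 'I_N,
    mu.-integrable `[r, T] (fun s => (f s (x s) 0 i)%:E) /\
    forall t, r <= t <= T ->
      x t 0 i = x0 0 i + \int[mu]_(s in `[r, t]) f s (x s) 0 i.

Definition Sf (f : R -> V -> V) (t r : R) (x0 : V) : V :=
  xget 0 [set y | exists x, is_solution f r x0 t x /\ x t = y].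

Definition pullback_absorbing (Sp : R -> R -> V -> V) (B : R -> set V) :=
  (forall t, B t !=set0 /\ bdd_set (B t)) /\
  forall t (D : set V), bdd_set D -> exists T : R, 0 < T /\
    forall s, T <= s -> Sp t (t - s) @` D `<=` B t.

Definition strongly_pbd (Sp : R -> R -> V -> V) (tau : R) :=
  exists B, pullback_absorbing Sp B /\
  forall D : set V, bdd_set D -> exists T : R, 0 < T /\
    forall t s, t <= tau -> T <= s -> Sp t (t - s) @` D `<=` B tau.

Definition hsdist (X Y : set V) : \bar R :=
  ereal_sup [set ereal_inf [set (enorm (x - y))%:E | y in Y] | x in X].

Definition pullback_attracts (Sp : R -> R -> V -> V) (C : R -> set V) :=
  forall t (D : set V), bdd_set D -> forall e : R, 0 < e ->
    exists s0 : R, forall s, s <= s0 -> (hsdist (Sp t s @` D) (C t) <= e%:E)%E.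

Definition pullback_attractor (Sp : R -> R -> V -> V) (A : R -> set V) :=
  (forall t, compact (A t)) /\
  (forall t s, s <= t -> Sp t s @` A s = A t) /\
  pullback_attracts Sp A /\
  (forall C : R -> set V, (forall t, closed (C t)) -> pullback_attracts Sp C ->
     forall t, A t `<=` C t).

End Defs.

(* Main.v *)
Require Import Defs.
From HB Require Import structures.
From mathcomp Require Import all_boot all_order all_algebra.
From mathcomp Require Import all_classical all_reals all_analysis.
From mathcomp Require Import measurable_realfun lra ring.
Set Implicit Arguments. Unset Strict Implicit. Unset Printing Implicit Defensive.
Import Order.TTheory GRing.Theory Num.Theory.
Import numFieldNormedType.Exports.
Local Open Scope classical_set_scope.
Local Open Scope ring_scope.

(* Along a solution, [y = |x|^2] satisfies [y' <= alpha y + beta], so by Gronwall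
   [|S(t,r) x|^2 <= exp (int_r^t alpha) |x|^2 + int_r^t exp (int_s^t alpha) beta(s) ds].
   (H2), which extends from [t <= 0] to [t <= tau] at the cost of a larger constant, makes
   the first term decay exponentially in [t - r]; splitting the second integral into unit
   intervals and using (H3) bounds it by a geometric series. Hence one ball absorbs
   [S(t,t-s) D] for all [t <= tau] and large [s], and the pullback omega-limit set of that
   ball is the attractor.

   Solutions are built by Picard iteration for the field cut off outside a large ball; the
   cut-off keeps the energy inequality with [|alpha|], so its solutions stay in the ball.
   The identities behind Gronwall and the energy balance, for functions that are merely
   integrals of [L^1_loc] functions, come from a comparison lemma for right increments. The
   inequality (H1), known for almost every [(t,x)], holds for almost every [t] and all [x]:
   where it fails it fails on a box by continuity of [f(t,.)], and the set of [t] for which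
   a given box lies in the section of a null set is null. *)

(** * Indefinite Lebesgue integrals *)

(** Locked so that tactics keep the integral folded. For [b < a] the segment is empty and the value
    is 0, with no sign reversal. *)
HB.lock Definition integ (R : realType) (h : R -> R) (a b : R) : R :=
  \int[@lebesgue_measure R]_(s in `[a, b]) h s.

Section ScalarIntegrals.
Context {R : realType}.
Local Notation mu := (@lebesgue_measure R).
Implicit Types (h g : R -> R) (a b c s t : R).

Lemma ae_imply (P Q : R -> Prop) : (forall s, P s -> Q s) ->
  {ae mu, forall s, P s} -> {ae mu, forall s, Q s}.
Proof. by move=> PQ; apply: filterS; first exact: (ae_filter_ringOfSetsType mu). Qed.

Lemma ae_and (P Q : R -> Prop) : {ae mu, forall s, P s} -> {ae mu, forall s, Q s} ->
  {ae mu, forall s, P s /\ Q s}.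
Proof. by move=> aP aQ; apply: filterI; first exact: (ae_filter_ringOfSetsType mu). Qed.

Lemma ae_nat (P : nat -> R -> Prop) : (forall n, {ae mu, forall s, P n s}) ->
  {ae mu, forall s, forall n, P n s}.
Proof.
move=> aP; apply: negligibleS (negligible_bigcup aP).
by move=> s /= /existsNP[n nP]; exists n.
Qed.

(** Integrability segment by segment is the form that the additivity and comparison lemmas consume;
    local integrability yields it because segments are compact. *)
Definition locint h := forall a b, mu.-integrable `[a, b] (EFin \o h).

Lemma locally_integrable_locint h : locally_integrable setT h -> locint h.
Proof.
move=> [mh _ hoo] a b; apply/integrableP; split.
  by apply/measurable_EFinP; apply: measurable_funS mh.
by apply: hoo => //; exact: segment_compact.
Qed.

Lemma locint_measurable h : locint h -> measurable_fun setT h.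
Proof.
move=> lh.
have -> : [set: R] = \bigcup_n `[- n%:R, n%:R]%classic.
  apply/seteqP; split => // x _.
  exists (Num.trunc `|x|).+1 => //=; rewrite in_itv/= -ler_norml.
  by apply/ltW/truncnS_gt.
apply/measurable_fun_bigcup => // n.
by have /integrableP[/measurable_EFinP] := lh (- n%:R) n%:R.
Qed.

Lemma locintD h g : locint h -> locint g -> locint (fun s => h s + g s).
Proof.
move=> lh lg a b.
exact: (@integrableD _ _ _ mu _ (measurable_itv _) _ _ (lh a b) (lg a b)).
Qed.

Lemma locintB h g : locint h -> locint g -> locint (fun s => h s - g s).
Proof.
move=> lh lg a b.
exact: (@integrableB _ _ _ mu _ (measurable_itv _) _ _ (lh a b) (lg a b)).
Qed.

Lemma locintZ h c : locint h -> locint (fun s => c * h s).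
Proof. by move=> lh a b; apply: (@integrableZl _ _ _ mu `[a, b]%classic _ c (EFin \o h)). Qed.

Lemma locint_abs h : locint h -> locint (fun s => `|h s|).
Proof. by move=> lh a b; have := integrable_abse (lh a b). Qed.

Lemma locint_dom h g : measurable_fun setT g -> locint h ->
  {ae mu, forall s, `|g s| <= h s} -> locint g.
Proof.
move=> mg lh [Z [mZ Z0 Zs]] a b.
have gm : measurable_fun (`[a, b]%classic : set R) (EFin \o g).
  by apply/measurable_EFinP; exact: measurable_funTS.
apply/(negligible_integrable (N := Z)) => //.
apply: (le_integrable _ _ _ (integrableS _ _ _ (lh a b))) => //.
- exact: measurableD.
- by apply: measurable_funS gm => //; exact: subDsetl.
- move=> x [_ nZx]; rewrite /= lee_fin.
  apply: le_trans (ler_norm _); apply: contrapT => H.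
  by apply: nZx; apply: Zs.
- exact: measurableD.
Qed.

Lemma locintM_continuous h g : locint h -> continuous g -> locint (fun s => h s * g s).
Proof.
move=> lh cg a b.
have mg : measurable_fun setT g by exact: continuous_measurable_fun.
have [M HM] : exists M, forall x, x \in `[a, b] -> `|g x| <= M.
  have [ab|ba] := leP a b; last first.
    exists 0 => x; rewrite in_itv/= => /andP[ax xb].
    by have := le_trans ax xb; rewrite leNgt ba.
  have [c _ Hc] := @EVT_max R (fun x => `|g x|) a b ab
     (continuous_subspaceT (fun x => continuous_comp (cg x) (@norm_continuous _ _ _))).
  by exists `|g c|.
have lM := @integrableZl _ _ _ mu `[a, b]%classic (measurable_itv _) M _ (lh a b).
apply: (le_integrable _ _ _ lM) => //.
  apply/measurable_EFinP; apply: measurable_funTS.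
  by apply: measurable_funM => //; exact: locint_measurable.
move=> x /= xab; rewrite lee_fin !normrM mulrC ler_wpM2r//.
by rewrite (le_trans (HM _ xab))// ler_norm.
Qed.

Lemma locint_continuous g : continuous g -> locint g.
Proof.
move=> cg.
have l1 : locint (cst 1).
  by apply: locally_integrable_locint; rewrite -indicT; exact: locally_integrable_indic openT _.
have := locintM_continuous l1 cg.
by under eq_fun do rewrite mul1r.
Qed.

Lemma locint_patch h a b :
  mu.-integrable `[a, b] (EFin \o h) -> locint (h \_ `[a, b]).
Proof.
move=> ih; apply: locally_integrable_locint.
exact: integrable_locally_restrict.
Qed.

Lemma integE h a b : integ h a b = \int[mu]_(s in `[a, b]) h s.
Proof. by rewrite integ.unlock. Qed.

Lemma integ_set1 h a : integ h a a = 0.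
Proof. by rewrite !integE set_itv1 Rintegral_set1. Qed.

Lemma integ_gt h a b : b < a -> integ h a b = 0.
Proof. by move=> ba; rewrite !integE set_itv_ge ?Rintegral_set0// bnd_simp -ltNge. Qed.

Lemma integ_chasles h a b c : locint h -> a <= b -> b <= c ->
  integ h a c = integ h a b + integ h b c.
Proof.
move=> lh ab bc; apply/eqP; rewrite addrC -subr_eq; apply/eqP.
rewrite !integE Rintegral_itvB ?bnd_simp//.
apply: Rintegral_itv_obnd_cbnd; apply: integrableS (lh b c) => //.
by apply: subset_itvr; rewrite bnd_simp.
Qed.

Lemma integD h g a b : locint h -> locint g ->
  integ (fun s => h s + g s) a b = integ h a b + integ g a b.
Proof. by move=> lh lg; rewrite !integE; apply: RintegralD. Qed.

Lemma integB h g a b : locint h -> locint g ->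
  integ (fun s => h s - g s) a b = integ h a b - integ g a b.
Proof. by move=> lh lg; rewrite !integE; apply: RintegralB. Qed.

Lemma integZ h c a b : locint h -> integ (fun s => c * h s) a b = c * integ h a b.
Proof. by move=> lh; rewrite !integE; apply: RintegralZl. Qed.

Lemma eq_integ h g a b : (forall s, a <= s -> s <= b -> h s = g s) ->
  integ h a b = integ g a b.
Proof.
move=> hg; rewrite !integE; apply: eq_Rintegral => s.
by rewrite inE/= in_itv/= => /andP[]; exact: hg.
Qed.

Lemma integ_sum n (h : 'I_n -> R -> R) a b : (forall i, locint (h i)) ->
  locint (fun s => \sum_(i < n) h i s) /\
  integ (fun s => \sum_(i < n) h i s) a b = \sum_(i < n) integ (h i) a b.
Proof.
elim: n h => [|n IH] h lh.
  under eq_fun do rewrite big_ord0; rewrite big_ord0; split.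
    by apply: locint_continuous => x; exact: cvg_cst.
  by rewrite !integE Rintegral_cst// mul0r.
have [l1 e1] := IH (fun i => h (widen_ord (leqnSn n) i)) (fun i => lh _).
under eq_fun do rewrite big_ord_recr/=; rewrite big_ord_recr/= -e1.
by split; [exact: locintD|rewrite integD].
Qed.

Lemma ae_le_integ h g a b : locint h -> locint g ->
  {ae mu, forall s, a <= s -> s <= b -> h s <= g s} -> integ h a b <= integ g a b.
Proof.
move=> lh lg H; rewrite -subr_ge0 -integB//.
rewrite !integE /Rintegral.
(* Almost everywhere on the segment [g - h] is its own absolute value, whose integral is nonnegative
   outright. *)
rewrite (_ : (\int[mu]_(x in `[a, b]) (g x - h x)%:E)%E =
             (\int[mu]_(x in `[a, b]) (`|g x - h x|)%:E)%E).
  by apply: fine_ge0; apply: integral_ge0 => x _; rewrite lee_fin.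
have lgh := locintB lg lh.
apply: ae_eq_integral => //.
- by have /integrableP[] := lgh a b.
- by have /integrableP[] := locint_abs lgh a b.
- case: H => Z [mZ Z0 Zs]; exists Z; split => // x /= H; apply: Zs => /= H2; apply: H.
  rewrite in_itv/= => /andP[ax xb]; congr EFin; rewrite ger0_norm//.
  by rewrite subr_ge0 H2.
Qed.

Lemma le_integ h g a b : locint h -> locint g ->
  (forall s, a <= s -> s <= b -> h s <= g s) -> integ h a b <= integ g a b.
Proof. by move=> lh lg H; apply: ae_le_integ => //; apply: aeW. Qed.

Lemma ae_integ_ge0 h a b : locint h -> {ae mu, forall s, 0 <= h s} ->
  0 <= integ h a b.
Proof.
move=> lh H; rewrite -(_ : integ (cst 0) a b = 0); last first.
  by rewrite !integE Rintegral_cst// mul0r.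
apply: ae_le_integ => //; first by apply: locint_continuous => x; exact: cvg_cst.
by apply: ae_imply H => s.
Qed.

Lemma integ_abs h a b : locint h -> `|integ h a b| <= integ (fun s => `|h s|) a b.
Proof. by move=> lh; rewrite !integE; apply: le_normr_Rintegral. Qed.

Lemma integ_abs_ge0 h a b : 0 <= integ (fun s => `|h s|) a b.
Proof. by rewrite integE; exact: Rintegral_ge0. Qed.

Lemma ae_integ_widen h a b c d : locint h -> {ae mu, forall s, 0 <= h s} ->
  c <= a -> b <= d -> integ h a b <= integ h c d.
Proof.
move=> lh h0 ca bd; have [ab|ba] := leP a b; last first.
  by rewrite (integ_gt _ ba) ae_integ_ge0.
rewrite (integ_chasles lh ca (le_trans ab bd)) (integ_chasles lh ab bd).
by have := ae_integ_ge0 c a lh h0; have := ae_integ_ge0 b d lh h0; lra.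
Qed.

Lemma integ_continuous h a : locint h -> continuous (integ h a).
Proof.
move=> lh t; pose c := Num.min a t - 1; pose d := t + 1.
have ca : c <= a by rewrite /c lerBlDr ge_min lerDl ler01.
have ct : c < t by rewrite /c ltrBlDr gt_min orbC ltrDl ltr01.
have td : t < d by rewrite /d ltrDl ltr01.
(* Cutting [h] to [[a, d]] lets the integral start at [c] without changing its value, even for upper
   ends before [a]; the point [t] is then interior to [[c, d]]. *)
pose h' := h \_ `[a, d].
have lh' : locint h' by exact: locint_patch.
have eF x : x <= d -> integ h a x = integ h' c x.
  move=> xd; rewrite !integE /h' -Rintegral_mkcondr; congr (Rintegral _ _ _).
  apply/seteqP; split => y /=; rewrite !in_itv/=.
    by move=> /andP[ay yx]; rewrite ay yx (le_trans ca ay) (le_trans yx xd).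
  by move=> [/andP[cy yx] /andP[ay _]]; rewrite ay yx.
have cd := lt_trans ct td.
have := parameterized_integral_continuous (ltW cd) (lh' c d).
move=> /(continuous_within_itvP _ cd)[/(_ t) + _ _]; rewrite in_itv/= ct td => /(_ isT).
rewrite /continuous_at /parameterized_integral -integE -(eF t (ltW td)).
apply: cvg_trans; apply: near_eq_cvg; near=> x; rewrite eF//.
  by rewrite integE.
near: x; apply/nbhs_ballP; exists 1 => //= x /=.
by rewrite /ball/= ltr_norml /d => /andP[]; lra.
Unshelve. all: by end_near. Qed.

Lemma continuous_eps h : continuous h -> forall s (e : R), 0 < e ->
  exists2 d : R, 0 < d & forall t, `|t - s| <= d -> `|h t - h s| <= e.
Proof.
move=> ch s e e0; have /cvgrPdist_le /(_ e e0) := ch s.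
move=> [d /= d0 H]; exists (d / 2); first by rewrite divr_gt0.
move=> t ts; rewrite distrC; apply: H => /=; rewrite distrC (le_lt_trans ts)//.
by rewrite ltr_pdivrMr// ltr_pMr// ltr1n.
Qed.

(* The set of [t] with [H t - e P t <= H a - e P a] is closed and can be
   prolonged to the right, so its supremum is [b]; then let [e] tend to 0. *)
Lemma right_dini_le (H P : R -> R) a b : a <= b -> continuous H -> continuous P ->
  (forall e s : R, 0 < e -> a <= s -> s < b -> exists2 d : R, 0 < d &
    forall t, s <= t -> t <= s + d -> t <= b -> H t - H s <= e * (P t - P s)) ->
  H b <= H a.
Proof.
move=> ab cH cP dH.
have key (e : R) : 0 < e -> H b - H a <= e * (P b - P a).
  move=> e0; pose G t := H t - e * P t.
  have cG : continuous G.
    move=> t; apply: cvgB; first exact: cH.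
    by apply: cvgM; [exact: cvg_cst|exact: cP].
  pose E := [set t | a <= t /\ t <= b /\ G t <= G a].
  have Ea : E a by [].
  have ubE : ubound E b by move=> t [_ []].
  have supE : has_sup E by split; [exists a|exists b].
  have cb : sup E <= b by apply: ge_sup; first by exists a.
  have ac : a <= sup E by apply: ub_le_sup => //; exists b.
  have Gc : G (sup E) <= G a.
    apply/ler_addgt0Pr => n n0.
    have [d d0 Hd] := continuous_eps cG (sup E) n0.
    have [t Et tc] := sup_adherent d0 supE.
    have tle : t <= sup E by apply: ub_le_sup => //; exists b.
    have /Hd : `|t - sup E| <= d by rewrite ler_norml; lra.
    by case: Et => _ [_ Gt]; rewrite ler_norml; lra.
  have [cb'|bc] := ltP (sup E) b; last first.
    have eb : sup E = b by apply/eqP; rewrite eq_le cb bc.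
    by move: Gc; rewrite eb /G; lra.
  have [d d0 Hd] := dH e (sup E) e0 ac cb'.
  pose t := Num.min (sup E + d) b.
  have tb : t <= b by rewrite ge_min lexx orbT.
  have td : t <= sup E + d by rewrite ge_min lexx.
  have ct : sup E < t by rewrite lt_min cb' ltrDl d0.
  have := Hd t (ltW ct) td tb => Ht.
  have : E t.
    split; first exact: le_trans ac (ltW ct).
    by split => //; move: Gc; rewrite /G; lra.
  move/(ub_le_sup (ex_intro _ b ubE)).
  by rewrite leNgt ct.
rewrite leNgt; apply/negP => Hab.
pose p := `|P b - P a| + 1.
have p0 : 0 < p by rewrite /p; have := normr_ge0 (P b - P a); lra.
have q0 : 0 < (H b - H a) / (2 * p) by rewrite divr_gt0 ?subr_gt0 ?mulr_gt0.
have := key _ q0.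
have : (H b - H a) / (2 * p) * (P b - P a) <= (H b - H a) / (2 * p) * p.
  by rewrite ler_pM2l// /p; have := ler_norm (P b - P a); lra.
have -> : (H b - H a) / (2 * p) * p = (H b - H a) / 2 by field; lra.
by lra.
Qed.

(** Used with [P] the integral of an absolute value: a function whose right increments are
    negligible against those of [P] is constant. This replaces differentiation, since the functions
    below are only integrals of locally integrable densities. *)
Lemma right_dini_eq (H P : R -> R) a b : a <= b -> continuous H -> continuous P ->
  (forall e s : R, 0 < e -> a <= s -> s < b -> exists2 d : R, 0 < d &
    forall t, s <= t -> t <= s + d -> t <= b -> `|H t - H s| <= e * (P t - P s)) ->
  H b = H a.
Proof.
move=> ab cH cP dH; apply/eqP; rewrite eq_le; apply/andP; split.
  apply: (right_dini_le ab cH cP) => e s e0 as_ sb.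
  have [d d0 Hd] := dH e s e0 as_ sb; exists d => // t st td tb.
  by have := Hd t st td tb; rewrite ler_norml => /andP[].
rewrite -lerN2.
apply: (@right_dini_le (fun t => - H t) P a b ab _ cP) => [t|e s e0 as_ sb].
  by apply: cvgN; exact: cH.
have [d d0 Hd] := dH e s e0 as_ sb; exists d => // t st td tb.
by have := Hd t st td tb; rewrite ler_norml; lra.
Qed.

Lemma integ_abs_le h g a b e : locint h -> continuous g ->
  (forall s, a <= s -> s <= b -> `|g s| <= e) ->
  `|integ (fun s => h s * g s) a b| <= e * integ (fun s => `|h s|) a b.
Proof.
move=> lh cg ge; have lhg := locintM_continuous lh cg.
apply: le_trans (integ_abs _ _ lhg) _.
rewrite -integZ; last exact: locint_abs.
apply: le_integ; [exact: locint_abs|exact/locintZ/locint_abs|].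
by move=> s as_ sb; rewrite normrM mulrC ler_wpM2r// ge.
Qed.

(** The defect [H] of the product rule has increments made of [f u * (G t - G u)] and
    [g u * (F s - F u)] integrated over [[s, t]]; continuity of [F] and [G] makes them small against
    the integral of [|f| + |g|]. *)
Lemma integM_rule (F G f g : R -> R) a : locint f -> locint g ->
  continuous F -> continuous G ->
  (forall t, a <= t -> F t = F a + integ f a t) ->
  (forall t, a <= t -> G t = G a + integ g a t) ->
  forall t, a <= t ->
    F t * G t = F a * G a + integ (fun s => f s * G s + g s * F s) a t.
Proof.
move=> lf lg cF cG eF eG b ab.
have lfG := locintM_continuous lf cG; have lgF := locintM_continuous lg cF.
have lfg := locintD lfG lgF.
pose H t := F t * G t - integ (fun s => f s * G s + g s * F s) a t.
pose P t := integ (fun s => `|f s| + `|g s|) a t.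
have lP : locint (fun s => `|f s| + `|g s|) by apply: locintD; exact: locint_abs.
suff : H b = H a by rewrite /H integ_set1; lra.
apply: (@right_dini_eq H P a b ab).
- move=> t; apply: cvgB; last exact: integ_continuous.
  by apply: cvgM; [exact: cF|exact: cG].
- exact: integ_continuous.
move=> e s e0 as_ sb.
have e20 : 0 < e / 2 by rewrite divr_gt0.
have [d1 d10 H1] := continuous_eps cF s e20.
have [d2 d20 H2] := continuous_eps cG s e20.
exists (Num.min d1 d2); first by rewrite lt_min d10.
move=> t st; rewrite -lerBlDl le_min => /andP[td1 td2] tb.
have at_ := le_trans as_ st.
have eFt : F t = F s + integ f s t.
  by rewrite (eF t at_) (eF s as_) (integ_chasles lf as_ st) addrA.
have eGt : G t = G s + integ g s t.
  by rewrite (eG t at_) (eG s as_) (integ_chasles lg as_ st) addrA.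
have -> : P t - P s = integ (fun s => `|f s|) s t + integ (fun s => `|g s|) s t.
  by rewrite /P (integ_chasles lP as_ st) (integD s t (locint_abs lf) (locint_abs lg)); ring.
have -> : H t - H s = integ (fun u => f u * (G t - G u)) s t
                    + integ (fun u => g u * (F s - F u)) s t.
  have E1 : integ (fun u => f u * (G t - G u)) s t =
            G t * integ f s t - integ (fun u => f u * G u) s t.
    rewrite -integZ// -integB//; last exact: locintZ.
    by apply: eq_integ => u _ _; ring.
  have E2 : integ (fun u => g u * (F s - F u)) s t =
            F s * integ g s t - integ (fun u => g u * F u) s t.
    rewrite -integZ// -integB//; last exact: locintZ.
    by apply: eq_integ => u _ _; ring.
  rewrite /H (integ_chasles lfg as_ st) (integD s t lfG lgF) E1 E2 eFt.
  by rewrite [in LHS]eGt [in RHS]eGt; ring.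
have cG' : continuous (fun u => G t - G u).
  by move=> u; apply: cvgB; [exact: cvg_cst|exact: cG].
have cF' : continuous (fun u => F s - F u).
  by move=> u; apply: cvgB; [exact: cvg_cst|exact: cF].
apply: le_trans (ler_normD _ _) _; rewrite mulrDr; apply: lerD.
  apply: integ_abs_le => // u su ut.
  have /H2 : `|u - s| <= d2 by rewrite ger0_norm; lra.
  have /H2 : `|t - s| <= d2 by rewrite ger0_norm; lra.
  by rewrite !ler_norml; lra.
apply: integ_abs_le => // u su ut.
have /H1 : `|u - s| <= d1 by rewrite ger0_norm; lra.
by rewrite !ler_norml; lra.
Qed.

(* [1 + x <= expR x] at [- D] and [D] bounds both sides. *)
Lemma expRN_remainder (w D : R) : 0 <= w ->
  `|w * expR (- D) - w + D * w| <= `|w * expR (- D) - w| * `|D|.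
Proof.
move=> w0; have := expR_ge1Dx (- D); have := expR_ge1Dx D.
have := expRxMexpNx_1 D; have := expR_gt0 (- D); have := expR_gt0 D.
move: (expR D) (expR (- D)) => p q p0 q0 pq pD qD.
have X2 : q - 1 <= - D * q by nra.
rewrite -normrM.
have Y1 : 0 <= w * q - w + D * w by nra.
have Y2 : w * q - w + D * w <= - ((w * q - w) * D) by nra.
by rewrite (ger0_norm Y1) (le_trans Y2)// -normrN ler_norm.
Qed.

(** This is [w' = - h w] for [w = exp (- int h)]. Over [[s, t]] the defect splits into a
    second-order remainder of the exponential and the integral of [h u * (w u - w s)], both
    negligible against the integral of [|h|]. *)
Lemma integ_expR_rule h a b : locint h -> a <= b ->
  expR (- integ h a b) = 1 - integ (fun s => h s * expR (- integ h a s)) a b.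
Proof.
move=> lh ab.
(* Introducing [w] through an equation keeps it opaque once [wE] is cleared. *)
have [w wE] : exists w, w = (fun t => expR (- integ h a t)) by eexists.
have cw : continuous w.
  rewrite wE => t; apply: continuous_comp; last exact: continuous_expR.
  by apply: cvgN; exact: integ_continuous.
have w0 t : 0 < w t by rewrite wE expR_gt0.
have wD s t : a <= s -> s <= t -> w t = w s * expR (- integ h s t).
  by move=> as_ st; rewrite wE (integ_chasles lh as_ st) opprD expRD.
have wa : w a = 1 by rewrite wE integ_set1 oppr0 expR0.
rewrite (_ : expR _ = w b); last by rewrite wE.
rewrite (_ : (fun s => h s * expR (- integ h a s)) = (fun s => h s * w s)); last by rewrite wE.
clear wE.
have lhw := locintM_continuous lh cw.
have la := locint_abs lh.
suff : w b + integ (fun s => h s * w s) a b = w a + integ (fun s => h s * w s) a a.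
  by rewrite integ_set1 wa; lra.
apply: (@right_dini_eq (fun t => w t + integ (fun s => h s * w s) a t)
                       (integ (fun s => `|h s|) a) a b ab).
- by move=> t; apply: cvgD; [exact: cw|exact: integ_continuous].
- exact: integ_continuous.
move=> e s e0 as_ sb.
have e20 : 0 < e / 2 by rewrite divr_gt0.
have [d d0 Hd] := continuous_eps cw s e20.
exists d => // t st td tb.
rewrite (integ_chasles la as_ st) (integ_chasles lhw as_ st).
have eI : integ (fun u => h u * w u) s t =
       integ (fun u => h u * (w u - w s)) s t + w s * integ h s t.
  rewrite -integZ// -integD; last 2 first.
  - apply: locintM_continuous => // u.
    by apply: cvgB; [exact: cw|exact: cvg_cst].
  - exact: locintZ.
  by apply: eq_integ => u _ _; ring.
have wts : `|w t - w s| <= e / 2 by apply: Hd; rewrite ger0_norm; lra.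
have cws : continuous (fun u => w u - w s).
  by move=> u; apply: cvgB; [exact: cw|exact: cvg_cst].
have I1 : `|integ (fun u => h u * (w u - w s)) s t| <= e / 2 * integ (fun s => `|h s|) s t.
  by apply: integ_abs_le => // u su ut; apply: Hd; rewrite ger0_norm; lra.
have I2 := integ_abs s t lh.
have I3 := expRN_remainder (integ h s t) (ltW (w0 s)).
rewrite -wD// in I3; rewrite eI.
have I4 : `|w t - w s| * `|integ h s t| <= e / 2 * integ (fun s => `|h s|) s t.
  by apply: ler_pM.
move: I1 I3 I4; move: (integ _ a s) (integ _ a s) (integ _ s t) (integ _ s t) (integ _ s t).
move=> A B C D E I1 I3 I4.
have -> : w t + (B + (E + w s * C)) - (w s + B) = (w t - w s + C * w s) + E by ring.
apply: le_trans (ler_normD _ _) _.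
by apply: le_trans (lerD (le_trans I3 I4) I1) _; lra.
Qed.

End ScalarIntegrals.

(** * Euclidean norm *)

Section Euclid.
Context {R : realType} {N : nat}.
Local Notation V := 'rV[R]_N.
Implicit Types (x y z : V).

Lemma dotpC x y : dotp x y = dotp y x.
Proof. by apply: eq_bigr => i _; rewrite mulrC. Qed.

Lemma dotpDl x y z : dotp (x + y) z = dotp x z + dotp y z.
Proof. by rewrite -big_split; apply: eq_bigr => i _; rewrite mxE mulrDl. Qed.

Lemma dotpZl (c : R) x y : dotp (c *: x) y = c * dotp x y.
Proof. by rewrite /dotp mulr_sumr; apply: eq_bigr => i _; rewrite mxE mulrA. Qed.

Lemma dotpNl x y : dotp (- x) y = - dotp x y.
Proof. by rewrite -scaleN1r dotpZl mulN1r. Qed.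

Lemma dotpBl x y z : dotp (x - y) z = dotp x z - dotp y z.
Proof. by rewrite dotpDl dotpNl. Qed.

Lemma dotp_ge0 x : 0 <= dotp x x.
Proof. by apply: sumr_ge0 => i _; rewrite -expr2 sqr_ge0. Qed.

Lemma enorm_ge0 x : 0 <= enorm x.
Proof. exact: sqrtr_ge0. Qed.

Lemma enorm_sqr x : enorm x ^+ 2 = dotp x x.
Proof. by rewrite sqr_sqrtr// dotp_ge0. Qed.

Lemma enorm0 : enorm (0 : V) = 0.
Proof. by rewrite /enorm /dotp big1 ?sqrtr0// => i _; rewrite mxE mul0r. Qed.

Lemma enormZ (c : R) x : enorm (c *: x) = `|c| * enorm x.
Proof. by rewrite /enorm dotpZl dotpC dotpZl mulrA -expr2 sqrtrM ?sqr_ge0// sqrtr_sqr. Qed.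

Lemma enormN x : enorm (- x) = enorm x.
Proof. by rewrite -scaleN1r enormZ normrN normr1 mul1r. Qed.

Lemma enormBC x y : enorm (x - y) = enorm (y - x).
Proof. by rewrite -enormN opprB. Qed.

Lemma coord_le_enorm x i : `|x 0 i| <= enorm x.
Proof.
rewrite -ler_sqr ?nnegrE ?normr_ge0 ?enorm_ge0// enorm_sqr real_normK ?num_real//.
rewrite /dotp (bigD1 i)//= -expr2 lerDl.
by apply: sumr_ge0 => j _; rewrite -expr2 sqr_ge0.
Qed.

Lemma enorm_eq0 x : enorm x = 0 -> x = 0.
Proof.
move=> x0; apply/rowP => i; rewrite mxE; apply/eqP.
by rewrite -normr_le0 -x0 coord_le_enorm.
Qed.

(** Cauchy-Schwarz, from the nonnegative square of the vector [|y|^2 x - <x, y> y]. *)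
Lemma dotp_le x y : `|dotp x y| <= enorm x * enorm y.
Proof.
have [y0|y0] := eqVneq (enorm y) 0.
  rewrite (enorm_eq0 y0) dotpC /dotp big1 ?normr0 ?enorm0 ?mulr0// => i _.
  by rewrite mxE mul0r.
have := dotp_ge0 (enorm y ^+ 2 *: x - dotp x y *: y).
rewrite dotpBl !dotpZl ![dotp _ (_ - _)]dotpC !dotpBl !dotpZl (dotpC y x) -!enorm_sqr.
have y2 : 0 < enorm y ^+ 2 by rewrite exprn_gt0// lt_def y0 enorm_ge0.
move: (dotp x y) y2 => d y2 H.
rewrite -ler_sqr ?nnegrE ?mulr_ge0 ?enorm_ge0// real_normK ?num_real// exprMn.
by move: H; move: (enorm x ^+ 2) (enorm y ^+ 2) y2 => p q q0 H; rewrite -(ler_pM2l q0); nra.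
Qed.

Lemma enormD x y : enorm (x + y) <= enorm x + enorm y.
Proof.
rewrite -ler_sqr ?nnegrE ?addr_ge0 ?enorm_ge0// enorm_sqr.
rewrite dotpDl ![dotp _ (_ + _)]dotpC !dotpDl (dotpC y x) -!enorm_sqr.
have := le_trans (ler_norm _) (dotp_le x y).
by move: (enorm x) (enorm y) (dotp x y) => a b c; nra.
Qed.

Lemma enormB_le x y z : enorm (x - z) <= enorm (x - y) + enorm (y - z).
Proof. by rewrite -[x - z](_ : (x - y) + (y - z) = _) ?enormD// addrA subrK. Qed.

Lemma enorm_dist x y : `|enorm x - enorm y| <= enorm (x - y).
Proof.
have := enormD (x - y) y; have := enormD (y - x) x.
by rewrite !subrK (enormBC y x) ler_norml; lra.
Qed.

Lemma enorm_le_sum x : enorm x <= \sum_(i < N) `|x 0 i|.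
Proof.
rewrite -ler_sqr ?nnegrE ?enorm_ge0 ?sumr_ge0// enorm_sqr expr2 mulr_suml.
apply: ler_sum => i _; rewrite -[leLHS]ger0_norm -?expr2 ?sqr_ge0// normrX expr2.
by rewrite ler_wpM2l// (bigD1 i)//= lerDl sumr_ge0.
Qed.

Lemma enorm_le_coord x (e : R) : (forall i, `|x 0 i| <= e) -> enorm x <= N%:R * e.
Proof.
move=> H; apply: le_trans (enorm_le_sum x) _.
apply: le_trans (ler_sum _ (fun i _ => H i)) _.
by rewrite sumr_const card_ord mulr_natl.
Qed.

(** The ambient topology comes from the sup norm, which is equivalent to the Euclidean one up to a
    factor [N]; [N + 1] keeps the division legal in dimension 0. *)
Lemma nbhs_enormP x (U : set V) :
  nbhs x U <-> exists2 e : R, 0 < e & forall y, enorm (x - y) < e -> U y.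
Proof.
split.
  move=> /nbhs_ballP[e /= e0 H]; exists e => // y xy; apply: H.
  split => // i j; rewrite ord1 /ball/=.
  by have := coord_le_enorm (x - y) j; rewrite !mxE => /le_lt_trans; apply.
move=> [e e0 H]; apply/nbhs_ballP.
have N0 : 0 < N%:R + 1 :> R by rewrite ltr_wpDl.
exists (e / (N%:R + 1)); first by rewrite /= divr_gt0.
move=> y [_ xy]; apply: H.
apply: (@le_lt_trans _ _ (N%:R * (e / (N%:R + 1)))).
  by apply: enorm_le_coord => i; have := xy 0 i; rewrite /ball/= !mxE => /ltW.
by rewrite mulrA ltr_pdivrMr// mulrC ltr_pM2l// ltrDl.
Qed.

Lemma closed_enormP (C : set V) : closed C <->
  forall x, (forall e : R, 0 < e -> exists2 y, C y & enorm (x - y) < e) -> C x.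
Proof.
split=> [cC x H|H x clx].
  apply: cC => U /nbhs_enormP[e e0 HU]; have [y Cy xy] := H e e0.
  by exists y; split => //; exact: HU.
apply: H => e e0.
have /clx[y [Cy xy]] : nbhs x [set y | enorm (x - y) < e].
  by apply/nbhs_enormP; exists e.
by exists y.
Qed.

Lemma closed_enorm_ball (r : R) : closed [set x : V | enorm x <= r].
Proof.
apply/closed_enormP => x H /=; apply/ler_addgt0Pr => e e0.
have [y /= yr xy] := H e e0.
by have := enormD (x - y) y; rewrite subrK; lra.
Qed.

Lemma compact_enorm_ball (r : R) : compact [set x : V | enorm x <= r].
Proof.
have cube : compact [set v : V | forall i, v ord0 i \in `[- r, r]].
  apply: (@rV_compact _ _ (fun=> `[- r, r]%classic)) => _.
  exact: segment_compact.
apply: subclosed_compact (@closed_enorm_ball r) cube _ => v /= vr i.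
by rewrite in_itv/= -ler_norml (le_trans (coord_le_enorm v i)).
Qed.

(** Compactness as the attractor needs it: the sets [P s] shrink as [s] tends to minus infinity and
    generate a proper filter on a closed ball, which has a cluster point. *)
Lemma enorm_cluster (r : R) (P : R -> set V) :
  (forall s t, s <= t -> P s `<=` P t) -> (forall s, P s !=set0) ->
  (forall s, P s `<=` [set x | enorm x <= r]) ->
  exists x, forall s (e : R), 0 < e -> exists2 y, P s y & enorm (x - y) < e.
Proof.
move=> Pmono Pne Pr.
pose F : set_system V := fun A => exists s, P s `<=` A.
have FF : ProperFilter F.
  split; first by move=> [s sub]; have [x /sub] := Pne s.
  split; first by exists 0.
    move=> A B [s sA] [t tB]; exists (Num.min s t) => x Px; split.
      by apply: sA; apply: Pmono Px; rewrite ge_min lexx.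
    by apply: tB; apply: Pmono Px; rewrite ge_min lexx orbT.
  by move=> A B AB [s sA]; exists s; exact: subset_trans AB.
have [x [_ cx]] := @compact_enorm_ball r F FF (ex_intro _ 0 (Pr 0)).
exists x => s e e0.
have [y [Py xy]] := cx (P s) [set y | enorm (x - y) < e]
  (ex_intro _ s (fun _ => id)) ((nbhs_enormP _ _).2 (ex_intro2 _ _ e e0 (fun _ => id))).
by exists y.
Qed.

Lemma row_continuous (x : R -> V) : (forall i, continuous (fun t => x t 0 i)) ->
  continuous x.
Proof.
move=> cx t U [P HP sub]; apply: (@filterS _ (nbhs t) _ (fun s => forall i, P 0 i (x s 0 i))).
  by move=> s H; apply: sub => i j; rewrite ord1.
apply: (@filter_forall _ _ (fun i s => P 0 i (x s 0 i)) (nbhs t)) => i.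
by apply: cx; exact: HP.
Qed.

Lemma continuous_nonexpansive (p : V -> R) (x : R -> V) :
  (forall y z, `|p y - p z| <= enorm (y - z)) ->
  (forall i, continuous (fun t => x t 0 i)) -> continuous (fun t => p (x t)).
Proof.
move=> pL cx t; apply/cvgrPdist_lt => e e0.
have /(row_continuous cx) : nbhs (x t) [set y | enorm (x t - y) < e].
  by apply/nbhs_enormP; exists e.
apply: (@filterS _ (nbhs t)) => s; apply: le_lt_trans; exact: pL.
Qed.

(** The sets with measurable preimage under [s -> (s, x s)] form a sigma-algebra, and it contains
    the open sets because [x] is continuous. *)
Lemma measurable_comp_borel (f : R -> V -> V) (x : R -> V) :
  borel_measurable_f f -> (forall i, continuous (fun t => x t 0 i)) ->
  forall i, measurable_fun setT (fun s => f s (x s) 0 i).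
Proof.
move=> bf cx i.
have key (A : set (R * V)) : borel_RxV A -> measurable [set s : R | A (s, x s)].
  move=> /(_ [set B | measurable [set s : R | B (s, x s)]]); apply; split.
    split => //=.
    - exact: measurable0.
    - move=> B mB; rewrite (_ : mkset _ = ~` [set s | B (s, x s)]); first exact: measurableC.
      by apply/seteqP; split => [s []|s].
    - by move=> F mF; exact: (bigcupT_measurable (fun n => [set s | F n (s, x s)])).
  move=> U oU /=; apply: open_measurable; rewrite openE => s Us.
  have : nbhs (s, x s) U by apply: open_nbhs_nbhs.
  move=> [[A1 A2] /= [n1 /(row_continuous cx) n2] sub].
  apply: (@filterS _ (nbhs s) _ _ _ _ (@filterI _ (nbhs s) _ _ _ n1 n2)) => t [t1 t2].
  exact: (sub (t, x t)).
apply: (measurability _ (RGenOInfty.measurableE R)) => //.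
move=> _ [_ [a ->] <-]; rewrite setTI.
rewrite (_ : _ @^-1` _ = [set s | [set p : R * V | [set y : V | a < y 0 i] (f p.1 p.2)] (s, x s)]);
  last by apply/seteqP; split => s /=; rewrite in_itv/= andbT.
apply: key.
apply: bf; rewrite openE => y /= ay; apply/nbhs_enormP; exists (y 0 i - a).
  by rewrite subr_gt0.
move=> z; have := coord_le_enorm (y - z) i; rewrite !mxE ler_norml => /andP[_].
by move=> ? ?; rewrite /=; lra.
Qed.

End Euclid.

(** * Caratheodory solutions by Picard iteration *)

Section Picard.
Context {R : realType}.
Local Notation mu := (@lebesgue_measure R).

(** Nested intervals about [u n] of half-width [2 * D / 2 ^+ n]: the half-width drops by exactly the
    allowed step, so the left ends increase, the right ends decrease, and the supremum of the left
    ends is the limit with an explicit error. *)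
Lemma geometric_cauchy (u : nat -> R) (D : R) : 0 <= D ->
  (forall n, `|u n.+1 - u n| <= D / 2 ^+ n) ->
  exists l, forall n, `|u n - l| <= 2 * D / 2 ^+ n.
Proof.
move=> D0 H.
have H2 n : 2 * D / 2 ^+ n.+1 = D / 2 ^+ n.
  by rewrite exprS invfM; field; rewrite expf_neq0.
have H3 n : 2 * D / 2 ^+ n = D / 2 ^+ n + D / 2 ^+ n by field; rewrite expf_neq0.
have e0 n : 0 <= D / 2 ^+ n by rewrite divr_ge0// exprn_ge0.
pose a n := u n - 2 * D / 2 ^+ n; pose b n := u n + 2 * D / 2 ^+ n.
have an n k : a n <= a (n + k)%N.
  elim: k => [|k IH]; first by rewrite addn0.
  apply: le_trans IH _; rewrite addnS /a H2 H3.
  by have := H (n + k)%N; rewrite ler_norml; lra.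
have bn n k : b (n + k)%N <= b n.
  elim: k => [|k IH]; first by rewrite addn0.
  apply: le_trans IH; rewrite addnS /b H2 H3.
  by have := H (n + k)%N; rewrite ler_norml; lra.
have ab m n : a m <= b n.
  apply: (le_trans (an m n)); apply: (le_trans _ (bn n m)).
  by rewrite addnC /a /b H3; have := e0 (n + m)%N; lra.
have supa : has_sup (range a).
  by split; [exists (a 0), 0|exists (b 0) => _ [n _ <-]].
exists (sup (range a)) => n.
have := ub_le_sup supa.2 (imageT a n).
have : sup (range a) <= b n.
  by apply: ge_sup; [case: supa|move=> _ [m _ <-]].
by rewrite /a /b ler_norml; lra.
Qed.

Lemma geometric_small (D e : R) : 0 < e -> exists n, D / 2 ^+ n < e.
Proof.
move=> e0; exists (Num.trunc (D / e)).+1.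
rewrite ltr_pdivrMr ?exprn_gt0// mulrC -ltr_pdivrMr//.
apply: lt_le_trans (truncnS_gt _) _.
by rewrite -natrX ler_nat ltnW// ltn_expl.
Qed.

Lemma le_geometric_eq0 (x D : R) : (forall n, `|x| <= D / 2 ^+ n) -> x = 0.
Proof.
move=> H; apply/eqP/contraT => x0.
have [n] : exists n, D / 2 ^+ n < `|x| by apply: geometric_small; rewrite normr_gt0.
by rewrite ltNge H.
Qed.

Context {N : nat}.
Local Notation V := 'rV[R]_N.
Variables (g : R -> V -> V) (m l : R -> R) (r : R) (x0 : V).
Hypothesis mg : forall x : R -> V, (forall i, continuous (fun t => x t 0 i)) ->
  forall i, measurable_fun setT (fun s => g s (x s) 0 i).
Hypotheses (lm : locint m) (ll : locint l).
Hypothesis gLip : {ae mu, forall t, forall x y : V,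
  enorm (g t x) <= m t /\ enorm (g t x - g t y) <= l t * enorm (x - y)}.

Lemma locint_comp (x : R -> V) i : (forall i, continuous (fun t => x t 0 i)) ->
  locint (fun s => g s (x s) 0 i).
Proof.
move=> cx; apply: locint_dom lm _; first exact: mg.
apply: ae_imply gLip => t H; apply: le_trans (coord_le_enorm _ _) _.
by case: (H (x t) (x t)).
Qed.

(** The integral from [r] vanishes for [t < r], so each iterate is defined on the whole line and
    constant before [r]. *)
Fixpoint picard_iter n : R -> V :=
  if n is n'.+1 then fun t => \row_i (x0 0 i + integ (fun s => g s (picard_iter n' s) 0 i) r t)
  else fun=> x0.

Lemma picard_iter_continuous n i : continuous (fun t => picard_iter n t 0 i).
Proof.
elim: n i => [|n IH] i /=; first by move=> t; exact: cvg_cst.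
under eq_fun do rewrite mxE.
move=> t; apply: cvgD; first exact: cvg_cst.
by apply: integ_continuous; exact: locint_comp.
Qed.

(** The factor [N] pays for passing from coordinatewise bounds to the Euclidean norm. *)
Let L t := N%:R * `|l t|.
Let lL : locint L. Proof. exact/locintZ/locint_abs. Qed.
(** Exponential weight [exp (2 * int L)]: measured against it, one Picard step halves distances,
    because the integral of [L * w] is [(w - 1) / 2]. *)
Let w t := expR (- integ (fun s => - 2 * L s) r t).

Let w_cont : continuous w.
Proof.
move=> t; apply: continuous_comp; last exact: continuous_expR.
by apply: cvgN; apply: integ_continuous; exact: locintZ.
Qed.

Let w_eq t : r <= t -> integ (fun s => L s * w s) r t = (w t - 1) / 2.
Proof.
move=> rt; have := integ_expR_rule (locintZ (- 2) lL) rt; rewrite -/(w t) => ->.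
under [in RHS]eq_fun do rewrite -/(w _) -mulrA.
by rewrite integZ; [lra|exact: locintM_continuous].
Qed.

Let w_ge1 t : 1 <= w t.
Proof.
rewrite -[leLHS]expR0 ler_expR integZ// mulNr opprK mulr_ge0//.
by apply: ae_integ_ge0 => //; apply: aeW => s; rewrite /L mulr_ge0.
Qed.

Let w_mono s t : s <= t -> w s <= w t.
Proof.
move=> st; rewrite ler_expR (integZ (-2) r s lL) (integZ (-2) r t lL).
rewrite !mulNr !opprK ler_pM2l//.
by apply: ae_integ_widen => //; apply: aeW => u; rewrite /L mulr_ge0.
Qed.

Let C t := integ (fun s => `|m s|) r t.

Let lip_integ (x y : R -> V) (v : R -> R) (t : R) i :
  (forall i, continuous (fun t => x t 0 i)) -> (forall i, continuous (fun t => y t 0 i)) ->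
  continuous v ->
  (forall s i, r <= s -> s <= t -> `|x s 0 i - y s 0 i| <= v s) ->
  `|integ (fun s => g s (x s) 0 i) r t - integ (fun s => g s (y s) 0 i) r t| <=
    integ (fun s => L s * v s) r t.
Proof.
move=> cx cy cv H; have lx := locint_comp i cx; have ly := locint_comp i cy.
rewrite -integB//; apply: le_trans (integ_abs _ _ (locintB lx ly)) _.
apply: ae_le_integ; [exact/locint_abs/locintB|exact: locintM_continuous|].
apply: ae_imply gLip => s /(_ (x s) (y s))[_ Hs] rs st.
have := coord_le_enorm (g s (x s) - g s (y s)) i; rewrite !mxE => /le_trans; apply.
apply: le_trans Hs _.
have Hn : enorm (x s - y s) <= N%:R * v s.
  by apply: enorm_le_coord => j; rewrite !mxE; exact: H.
rewrite /L; apply: (@le_trans _ _ (`|l s| * enorm (x s - y s))).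
  by rewrite ler_wpM2r ?enorm_ge0// ler_norm.
by rewrite mulrAC [leRHS]mulrC ler_wpM2l.
Qed.

Lemma picard_iter_lt n t i : t < r -> picard_iter n t 0 i = x0 0 i.
Proof. by move=> tr; case: n => [//|n]; rewrite /= mxE integ_gt ?addr0. Qed.

(** The first increment is at most the integral of [|m|], and each further step gains a factor 1/2
    through the weight. Before [r] all iterates agree. *)
Let step T n t i : t <= T ->
  `|picard_iter n.+1 t 0 i - picard_iter n t 0 i| <= C T / 2 ^+ n * w t.
Proof.
have C0 : 0 <= C T by exact: integ_abs_ge0.
elim: n t i => [|n IH] t i tT.
  rewrite /= mxE addrC addKr expr0 divr1.
  apply: (@le_trans _ _ (C T)); last by rewrite ler_peMr.
  have ci (i0 : 'I_N) : continuous (fun _ : R => x0 0 i0) by move=> ?; exact: cvg_cst.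
  have lc := locint_comp i ci.
  apply: le_trans (integ_abs _ _ lc) _.
  apply: (@le_trans _ _ (integ (fun s => `|m s|) r t)).
    apply: ae_le_integ; [exact: locint_abs..|].
    apply: ae_imply gLip => s /(_ x0 x0)[H _] _ _.
    apply: le_trans (coord_le_enorm _ _) (le_trans H (ler_norm _)).
  apply: ae_integ_widen => //; first exact: locint_abs.
  exact: aeW.
have [tr|rt] := ltP t r.
  rewrite !picard_iter_lt// subrr normr0 mulr_ge0 ?divr_ge0 ?exprn_ge0//.
  exact: le_trans ler01 (w_ge1 t).
have -> : picard_iter n.+2 t 0 i - picard_iter n.+1 t 0 i =
    integ (fun s => g s (picard_iter n.+1 s) 0 i) r t -
    integ (fun s => g s (picard_iter n s) 0 i) r t.
  by rewrite /= !mxE opprD addrACA subrr add0r.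
apply: le_trans (lip_integ i (@picard_iter_continuous n.+1)
  (@picard_iter_continuous n) (v := fun s => C T / 2 ^+ n * w s) _ _) _.
- by move=> s; apply: cvgM; [exact: cvg_cst|exact: w_cont].
- by move=> s j rs st; apply: IH; exact: le_trans tT.
rewrite (_ : (fun s => _) = (fun s => C T / 2 ^+ n * (L s * w s))); last first.
  by apply/funext => s; rewrite mulrCA.
rewrite integZ; last exact: locintM_continuous.
rewrite w_eq//.
have -> : C T / 2 ^+ n.+1 * w t = C T / 2 ^+ n * (w t / 2).
  rewrite exprS; have : 2 ^+ n != 0 :> R by rewrite expf_neq0.
  by move: (2 ^+ n) (C T) (w t) => p q v p0; field; rewrite p0.
rewrite ler_wpM2l ?divr_ge0 ?exprn_ge0//.
by rewrite ler_pM2r ?invr_gt0// gerBl.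
Qed.

(** The error of iterate [n] is uniform on [t <= T], which carries continuity over to the limit; the
    limit satisfies the integral equation because its defect is below a constant over [2 ^+ n] for
    every [n]. *)
Lemma picard : exists x : R -> V, (forall i, continuous (fun t => x t 0 i)) /\
  forall i, locint (fun s => g s (x s) 0 i) /\
    forall t, x t 0 i = x0 0 i + integ (fun s => g s (x s) 0 i) r t.
Proof.
have C0 T : 0 <= C T by exact: integ_abs_ge0.
have w0 t : 0 <= w t by exact: le_trans ler01 (w_ge1 t).
pose D T := C T * w T.
have D0 T : 0 <= D T by exact: mulr_ge0.
have stepD T n t i : t <= T ->
    `|picard_iter n.+1 t 0 i - picard_iter n t 0 i| <= D T / 2 ^+ n.
  move=> tT; apply: le_trans (step n i tT) _.
  by rewrite /D mulrAC ler_wpM2r ?invr_ge0 ?exprn_ge0// ler_wpM2l// w_mono.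
have ex t i : exists y, forall n, `|picard_iter n t 0 i - y| <= 2 * D t / 2 ^+ n.
  exact: geometric_cauchy (fun n => stepD t n t i (lexx t)).
pose x t : V := \row_i sval (cid (ex t i)).
have xP t i n : `|picard_iter n t 0 i - x t 0 i| <= 2 * D t / 2 ^+ n.
  by rewrite mxE; case: cid.
have D_mono s t : s <= t -> D s <= D t.
  move=> st; apply: ler_pM => //; last exact: w_mono.
  by apply: ae_integ_widen => //; [exact: locint_abs|exact: aeW].
have xPT T t i n : t <= T -> `|picard_iter n t 0 i - x t 0 i| <= 2 * D T / 2 ^+ n.
  move=> tT; apply: le_trans (xP t i n) _.
  by rewrite ler_wpM2r ?invr_ge0 ?exprn_ge0// ler_wpM2l// D_mono.
have cx i : continuous (fun t => x t 0 i).
  move=> t; apply/cvgrPdist_lt => e e0; have e30 : 0 < e / 3 by rewrite divr_gt0.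
  have [n nD] := geometric_small (2 * D (t + 1)) e30.
  have /cvgrPdist_lt /(_ _ e30) Hc := @picard_iter_continuous n i t.
  near=> s.
  have st : s <= t + 1.
    near: s; apply/nbhs_ballP; exists 1 => //= s /=.
    by rewrite /ball/= ltr_norml => /andP[]; lra.
  have Xs := xPT _ _ i n st.
  have Xt : `|picard_iter n t 0 i - x t 0 i| <= 2 * D (t + 1) / 2 ^+ n.
    by apply: xPT; rewrite lerDl.
  have Xst : `|picard_iter n t 0 i - picard_iter n s 0 i| < e / 3 by near: s.
  move: Xs Xt Xst (nD); move: (picard_iter n s 0 i) (picard_iter n t 0 i) (x s 0 i) (x t 0 i).
  move: (2 * D (t + 1) / 2 ^+ n) => q a b c d.
  by rewrite !ler_norml !ltr_norml; lra.
exists x; split => // i; split; first exact: locint_comp.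
move=> t; apply/eqP; rewrite -subr_eq0; apply/eqP.
(* [D t] accounts for the error of iterate [n + 1], and the integral for what the Lipschitz bound
   makes of the error of iterate [n]. *)
apply: (@le_geometric_eq0 _ (D t + integ (fun s => L s * (2 * D t)) r t)) => n.
have cX := @picard_iter_continuous n.
have c2 : continuous (fun _ : R => 2 * D t / 2 ^+ n) by move=> ?; exact: cvg_cst.
have I := @lip_integ _ _ _ t i cX cx c2 (fun s j _ st => xPT t s j n st).
have J := xP t i n.+1; rewrite /= mxE in J.
have E : integ (fun s => L s * (2 * D t / 2 ^+ n)) r t =
    integ (fun s => L s * (2 * D t)) r t / 2 ^+ n.
  have lc : locint (fun s => L s * (2 * D t)).
    by apply: locintM_continuous => // ?; exact: cvg_cst.
  rewrite [RHS]mulrC -(integZ _ _ _ lc); apply: eq_integ => s _ _.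
  by rewrite mulrA mulrC.
rewrite {}E in I.
have E : 2 * D t / 2 ^+ n.+1 = D t / 2 ^+ n.
  by rewrite exprS; field; rewrite expf_neq0.
rewrite {}E in J; rewrite mulrDl.
move: I J; move: (integ _ r t) (integ (fun s => g s (x s) 0 i) r t) (x0 0 i) (x t 0 i).
move: (D t / 2 ^+ n) (_ / 2 ^+ n) => p q a b c d.
by rewrite !ler_norml; lra.
Unshelve. all: by end_near. Qed.

End Picard.

(** * Trajectories and the energy estimate *)

Section Gronwall.
Context {R : realType}.
Local Notation mu := (@lebesgue_measure R).

Lemma continuous_expR_integ (h : R -> R) a : locint h -> continuous (fun t => expR (- integ h a t)).
Proof.
move=> lh t; apply: continuous_comp; last exact: continuous_expR.
by apply: cvgN; exact: integ_continuous.
Qed.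

(** Integrating factor: with [w = exp (- int alpha)] the product [y * w] has density
    [q * w - alpha * w * y], which is at most [beta * w]. *)
Lemma gronwall_integ (y q alpha beta : R -> R) r T : r <= T ->
  continuous y -> locint q -> locint alpha -> locint beta ->
  (forall t, r <= t -> y t = y r + integ q r t) ->
  {ae mu, forall s, r <= s -> s <= T -> q s <= alpha s * y s + beta s} ->
  y T <= expR (integ alpha r T) * y r
         + expR (integ alpha r T) * integ (fun s => beta s * expR (- integ alpha r s)) r T.
Proof.
move=> rT cy lq la lb yE qle.
have [w wE] : exists w, w = (fun t => expR (- integ alpha r t)) by eexists.
have cw : continuous w by rewrite wE; exact: continuous_expR_integ.
have w0 t : 0 < w t by rewrite wE expR_gt0.
have wr : w r = 1 by rewrite wE integ_set1 oppr0 expR0.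
have wI t : r <= t -> w t = w r + integ (fun s => - 1 * (alpha s * w s)) r t.
  move=> rt; rewrite integZ; last exact: locintM_continuous.
  by rewrite wr {1}wE (integ_expR_rule la rt) wE mulN1r.
have wT : expR (integ alpha r T) * w T = 1 by rewrite wE expRxMexpNx_1.
rewrite (_ : (fun s => beta s * expR _) = (fun s => beta s * w s)); last by rewrite wE.
clear wE.
have law := locintM_continuous la cw.
have lmw : locint (fun s => - 1 * (alpha s * w s)) by exact: locintZ.
have P := integM_rule lq lmw cy cw yE wI rT.
have I : integ (fun s => q s * w s + - 1 * (alpha s * w s) * y s) r T
      <= integ (fun s => beta s * w s) r T.
  apply: ae_le_integ.
  - by apply: locintD; exact: locintM_continuous.
  - exact: locintM_continuous.
  apply: ae_imply qle => s H rs sT; have := H rs sT; have := w0 s.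
  by move: (q s) (alpha s) (w s) (y s) (beta s) => a b c d e; nra.
have e0 := expR_gt0 (integ alpha r T).
rewrite -mulrDr -[leLHS]mul1r -wT -mulrA ler_pM2l// mulrC P wr mulr1.
by rewrite lerD2l.
Qed.

End Gronwall.

Section Trajectories.
Context {R : realType} {N : nat}.
Local Notation V := 'rV[R]_N.
Local Notation mu := (@lebesgue_measure R).
Implicit Types (f : R -> V -> V) (x y h k : R -> V) (r T : R).

(* [h] equals [f t (x t)] only on [[r, T]], but [x] is its integral from [r] on the
   whole line, hence continuous everywhere and constant before [r]. *)
Definition trajectory f r (x0 : V) T x h :=
  [/\ forall i, continuous (fun t => x t 0 i),
      forall i, locint (fun t => h t 0 i),
      forall t i, x t 0 i = x0 0 i + integ (fun s => h s 0 i) r t &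
      forall t, r <= t -> t <= T -> h t = f t (x t)].

Lemma trajectory_init f r (x0 : V) T x h : trajectory f r x0 T x h -> x r = x0.
Proof.
by move=> [_ _ E _]; apply/rowP => i; rewrite E integ_set1 addr0.
Qed.

Lemma trajectory_solution f r (x0 : V) T x h : trajectory f r x0 T x h -> is_solution f r x0 T x.
Proof.
move=> tx; split; first exact: trajectory_init tx.
case: tx => _ lh E hE i; split.
  apply: eq_integrable (lh i r T) => // s; rewrite inE/= in_itv/= => /andP[rs sT].
  by rewrite hE.
move=> t /andP[rt tT]; rewrite E integE; congr (_ + _).
apply: eq_Rintegral => s; rewrite inE/= in_itv/= => /andP[rs st].
by rewrite hE// (le_trans st).
Qed.

(** A solution is unconstrained outside [[r, T]]; its velocity is set to 0 there and integrated
    again, which changes nothing on [[r, T]]. *)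
Lemma solution_trajectory f r (x0 : V) T x : is_solution f r x0 T x ->
  exists x' h, trajectory f r x0 T x' h /\ forall t, r <= t -> t <= T -> x' t = x t.
Proof.
move=> [xr sx].
pose h (s : R) : V := \row_i ((fun s => f s (x s) 0 i) \_ `[r, T]) s.
have lh i : locint (fun t => h t 0 i).
  under eq_fun do rewrite mxE.
  by apply: locint_patch; case: (sx i).
pose x' (t : R) : V := \row_i (x0 0 i + integ (fun s => h s 0 i) r t).
have xx t : r <= t -> t <= T -> x' t = x t.
  move=> rt tT; apply/rowP => i; rewrite mxE.
  have [_ ->] := sx i; last by rewrite rt tT.
  congr (_ + _); rewrite integE; apply: eq_Rintegral => s.
  rewrite inE/= in_itv/= => /andP[rs st].
  by rewrite mxE patchE mem_set//= in_itv/= rs (le_trans st tT).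
exists x', h; split => //; split => //.
- move=> i t; under eq_fun do rewrite mxE.
  by apply: cvgD; [exact: cvg_cst|exact: integ_continuous].
- by move=> t i; rewrite mxE.
- move=> t rt tT; apply/rowP => i.
  by rewrite mxE patchE mem_set/= ?in_itv/= ?rt ?tT// xx.
Qed.

Lemma energy_integ x h r :
  (forall i, continuous (fun t => x t 0 i)) -> (forall i, locint (fun t => h t 0 i)) ->
  (forall t i, r <= t -> x t 0 i = x r 0 i + integ (fun s => h s 0 i) r t) ->
  [/\ continuous (fun t => dotp (x t) (x t)),
      locint (fun s => 2 * dotp (h s) (x s)) &
      forall t, r <= t ->
        dotp (x t) (x t) = dotp (x r) (x r) + integ (fun s => 2 * dotp (h s) (x s)) r t].
Proof.
move=> cx lh E.
have lhx i : locint (fun s => h s 0 i * x s 0 i + h s 0 i * x s 0 i).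
  by apply: locintD; exact: locintM_continuous.
have hE : (fun s => 2 * dotp (h s) (x s)) =
    (fun s => \sum_(i < N) (h s 0 i * x s 0 i + h s 0 i * x s 0 i)).
  by apply/funext => s; rewrite big_split/= -/(dotp _ _); lra.
split.
- apply: continuous_big => [|i _ t]; first exact: add_continuous.
  by apply: cvgM; exact: cx.
- by rewrite hE; case: (integ_sum 0 0 lhx).
- move=> t rt; rewrite hE; have [_ ->] := integ_sum r t lhx.
  rewrite /dotp -big_split; apply: eq_bigr => i _.
  exact: (integM_rule (lh i) (lh i) (cx i) (cx i) (fun t rt => E t i rt) (fun t rt => E t i rt)).
Qed.

End Trajectories.

(** Makes the cut-off in the existence proof 1-Lipschitz. *)
Lemma clamp_nonexpansive (R : realType) (a b : R) :
  `|Num.max 0 (Num.min 1 a) - Num.max 0 (Num.min 1 b)| <= `|a - b|.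
Proof.
have := ler_norm (a - b); have := ler_norm (b - a); rewrite (distrC b a).
move: `|a - b| => d; rewrite !maxEle !minEle ler_norml.
by do ![case: ifPn => //]; rewrite -?ltNge; lra.
Qed.

(** * The solution process of a dissipative field: existence, bounds, uniqueness *)

Section Dissipative.
Context {R : realType} {N : nat}.
Local Notation V := 'rV[R]_N.
Local Notation mu := (@lebesgue_measure R).
Variables (f : R -> V -> V) (alpha beta : R -> R).
Hypothesis mf : borel_measurable_f f.
Hypothesis fLip : forall rho : R, exists m l : R -> R, [/\ locint m, locint l &
  {ae mu, forall t, forall x y, enorm x <= rho -> enorm y <= rho ->
     enorm (f t x) <= m t /\ enorm (f t x - f t y) <= l t * enorm (x - y)}].
Hypotheses (la : locint alpha) (lb : locint beta).
Hypothesis beta0 : {ae mu, forall t, 0 <= beta t}.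
Hypothesis fdis : {ae mu, forall t, forall x,
  2 * dotp (f t x) x <= alpha t * enorm x ^+ 2 + beta t}.

Lemma trajectory_energy r x0 T x h : r <= T -> trajectory f r x0 T x h ->
  enorm (x T) ^+ 2 <= expR (integ alpha r T) * enorm x0 ^+ 2
    + expR (integ alpha r T) * integ (fun s => beta s * expR (- integ alpha r s)) r T.
Proof.
move=> rT tx; have x0E := trajectory_init tx; case: tx => cx lh E hE.
have [|cd ld dE] := energy_integ (r := r) cx lh.
  by move=> t i rt; rewrite x0E.
rewrite !enorm_sqr -x0E.
apply: (gronwall_integ rT cd ld la lb dE).
apply: ae_imply fdis => s H rs sT.
by rewrite hE// -enorm_sqr.
Qed.

(** Gronwall for [|x - y|^2], whose density is at most [2 * l] times itself by Cauchy-Schwarz. The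
    same [l] serves all trajectories staying in the ball of radius [rho]. *)
Lemma trajectory_lipschitz rho : exists2 l : R -> R, locint l &
  forall r T x0 y0 x y h k, r <= T ->
    trajectory f r x0 T x h -> trajectory f r y0 T y k ->
    (forall t, r <= t -> t <= T -> enorm (x t) <= rho /\ enorm (y t) <= rho) ->
    enorm (x T - y T) ^+ 2 <= expR (integ l r T) * enorm (x0 - y0) ^+ 2.
Proof.
have [m [l [_ ll Lip]]] := fLip rho.
exists (fun s => 2 * l s); first exact: locintZ.
move=> r T x0 y0 x y h k rT tx ty bd.
have x0E := trajectory_init tx; have y0E := trajectory_init ty.
case: tx => cx lh Ex hE; case: ty => cy lk Ey kE.
have cz i : continuous (fun t => (x t - y t) 0 i).
  by under eq_fun do rewrite !mxE; move=> t; apply: cvgB; [exact: cx|exact: cy].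
have lz i : locint (fun t => (h t - k t) 0 i).
  by under eq_fun do rewrite !mxE; exact: locintB.
have [|cd ld dE] := energy_integ (r := r) cz lz.
  move=> t i rt; rewrite !mxE.
  under [X in integ X]eq_fun do rewrite !mxE.
  by rewrite integB// Ex Ey x0E y0E; ring.
rewrite !enorm_sqr -x0E -y0E.
have l0 : locint (fun _ : R => 0 : R) by apply: locint_continuous => ?; exact: cvg_cst.
have := gronwall_integ rT cd ld (locintZ 2 ll) l0 dE.
rewrite [X in _ -> _ <= _ + _ * X](_ : _ = 0); last first.
  rewrite integE (eq_Rintegral _ (g := fun=> 0)) ?Rintegral_cst ?mul0r//.
  by move=> s _; rewrite mul0r.
rewrite mulr0 addr0; apply.
apply: ae_imply Lip => s H rs sT; rewrite addr0.
have [bx by_] := bd s rs sT.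
have [_ Hs] := H _ _ bx by_.
rewrite hE// kE// -mulrA ler_pM2l// -enorm_sqr expr2 mulrA.
apply: le_trans (ler_norm _) (le_trans (dotp_le _ _) _).
by rewrite ler_wpM2r ?enorm_ge0.
Qed.

Lemma trajectory_exists r x0 T : r <= T -> exists x h, trajectory f r x0 T x h.
Proof.
move=> rT.
(* Gronwall with [|alpha|] and [|beta|] will bound the squared norm on [[r, T]] by [Q], hence the
   norm by [Q + 1]. *)
pose Q := expR (integ (fun s => `|alpha s|) r T) *
  (enorm x0 ^+ 2 + integ (fun s => `|beta s|) r T).
pose rho := Q + 1.
have [m [l [lm ll Lip]]] := fLip (rho + 1).
(* Cut-off equal to 1 up to radius [rho] and to 0 beyond [rho + 1], the radius on which [f] is
   controlled. *)
pose phi (x : V) := Num.max 0 (Num.min 1 (rho + 1 - enorm x)).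
have phi0 x : 0 <= phi x by rewrite le_max lexx.
have phi1 x : phi x <= 1 by rewrite ge_max ler01 ge_min lexx.
have phiE x : enorm x <= rho -> phi x = 1.
  by move=> xr; rewrite /phi min_l ?max_r// lerBrDl lerD.
have phiz x : rho + 1 < enorm x -> phi x = 0.
  move=> xr; rewrite /phi min_r ?max_l//; lra.
have phiL x y : `|phi x - phi y| <= enorm (x - y).
  apply: le_trans (clamp_nonexpansive _ _) _.
  by rewrite opprB addrC addrA subrK distrC; exact: enorm_dist.
pose g t x := phi x *: f t x.
have gLip : {ae mu, forall t, forall x y : V, enorm (g t x) <= `|m t| /\
    enorm (g t x - g t y) <= (`|l t| + `|m t|) * enorm (x - y)}.
  apply: ae_imply Lip => t H.
  have fm x : enorm x <= rho + 1 -> enorm (f t x) <= `|m t|.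
    by move=> xr; have [+ _] := H x x xr xr; move/le_trans; apply; exact: ler_norm.
  have fl x y : enorm x <= rho + 1 -> enorm y <= rho + 1 ->
      enorm (f t x - f t y) <= `|l t| * enorm (x - y).
    move=> xr yr; have [_ /le_trans] := H x y xr yr; apply.
    by rewrite ler_wpM2r ?enorm_ge0// ler_norm.
  have gz x : rho + 1 < enorm x -> g t x = 0.
    by move=> /phiz; rewrite /g => ->; rewrite scale0r.
  (* Here [g] vanishes at [y], where no bound on [f] is at hand; since [phi y = 0], the factor
     [phi x] is itself at most the distance. *)
  have half x y : enorm x <= rho + 1 -> rho + 1 < enorm y ->
      enorm (g t x - g t y) <= (`|l t| + `|m t|) * enorm (x - y).
    move=> xr yr; rewrite (gz y yr) subr0 /g enormZ.
    have := phiL x y; rewrite (phiz y yr) subr0 => px.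
    rewrite mulrDl -[leLHS]add0r; apply: lerD; first by rewrite mulr_ge0 ?enorm_ge0.
    by rewrite mulrC; apply: ler_pM => //; [exact: enorm_ge0|exact: fm].
  move=> x y; split.
    have [xr|xr] := leP (enorm x) (rho + 1); last by rewrite gz// enorm0.
    rewrite /g enormZ ger0_norm//; apply: le_trans (fm x xr).
    by rewrite ler_piMl ?enorm_ge0.
  have [xr|xr] := leP (enorm x) (rho + 1); have [yr|yr] := leP (enorm y) (rho + 1).
  - have -> : g t x - g t y = phi x *: (f t x - f t y) + (phi x - phi y) *: f t y.
      by rewrite /g scalerBr scalerBl addrA subrK.
    apply: le_trans (enormD _ _) _; rewrite !enormZ mulrDl ger0_norm//; apply: lerD.
      by apply: le_trans (fl x y xr yr); rewrite ler_piMl ?enorm_ge0.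
    by rewrite mulrC; apply: ler_pM => //; [exact: enorm_ge0|exact: fm].
  - exact: half.
  - by rewrite [leLHS]enormBC (enormBC x y); exact: half.
  - by rewrite !gz// subrr enorm0 mulr_ge0 ?addr_ge0 ?enorm_ge0.
have mg (x : R -> V) : (forall i, continuous (fun t => x t 0 i)) ->
    forall i, measurable_fun setT (fun s => g s (x s) 0 i).
  move=> cx i; rewrite /g; under eq_fun do rewrite mxE.
  apply: measurable_funM; last exact: measurable_comp_borel.
  by apply: continuous_measurable_fun; exact: continuous_nonexpansive.
have laa := locint_abs la; have lba := locint_abs lb.
have [x [cx xI]] := picard (m := fun t => `|m t|) (l := fun t => `|l t| + `|m t|) r x0 mg
  (locint_abs lm) (locintD (locint_abs ll) (locint_abs lm)) gLip.
have lg i : locint (fun s => g s (x s) 0 i) by case: (xI i).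
have xE t i : x t 0 i = x0 0 i + integ (fun s => g s (x s) 0 i) r t by case: (xI i).
have xr0 : x r = x0 by apply/rowP => i; rewrite xE integ_set1 addr0.
have [|cd ld dE] := energy_integ (r := r) cx lg.
  by move=> t i rt; rewrite xr0.
have xrho t : r <= t -> t <= T -> enorm (x t) <= rho.
  move=> rt tT.
  have G := gronwall_integ rt cd ld laa lba dE.
  have {G}/G : {ae mu, forall s, r <= s -> s <= t ->
      2 * dotp (g s (x s)) (x s) <= `|alpha s| * dotp (x s) (x s) + `|beta s|}.
    apply: ae_imply (ae_and fdis beta0) => s [H b0] rs st.
    rewrite /g dotpZl mulrCA -enorm_sqr.
    have := H (x s); have := phi0 (x s); have := phi1 (x s).
    have := ler_norm (alpha s); rewrite (ger0_norm b0).
    have := sqr_ge0 (enorm (x s)); have := normr_ge0 (alpha s).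
    move: (enorm (x s) ^+ 2) (phi (x s)) (2 * dotp _ _) (alpha s) `|alpha s| (beta s) b0.
    move=> y p d a a' b b0 a0 y0 aa' p1 p0 dle.
    (* Scaling by a factor in [[0, 1]] preserves an upper bound only if that bound is nonnegative,
       which is why [alpha] was replaced by its absolute value. *)
    apply: (@le_trans _ _ (p * (a' * y + b))).
      by rewrite ler_wpM2l// (le_trans dle)// lerD2r ler_wpM2r.
    by rewrite ler_piMl// addr_ge0// mulr_ge0.
  rewrite xr0 -!enorm_sqr -mulrDr => G.
  have B : integ (fun s => `|beta s| * expR (- integ (fun s => `|alpha s|) r s)) r t
        <= integ (fun s => `|beta s|) r T.
    apply: (@le_trans _ _ (integ (fun s => `|beta s|) r t)).
      apply: le_integ => //.
        by apply: locintM_continuous => //; exact: continuous_expR_integ.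
      move=> s _ _; rewrite ler_piMr// -[leRHS]expR0 ler_expR oppr_le0.
      exact: integ_abs_ge0.
    by apply: ae_integ_widen => //; exact: aeW.
  have A : expR (integ (fun s => `|alpha s|) r t) <= expR (integ (fun s => `|alpha s|) r T).
    by rewrite ler_expR; apply: ae_integ_widen => //; exact: aeW.
  have Q0 : 0 <= enorm x0 ^+ 2 + integ (fun s => `|beta s|) r T.
    by rewrite addr_ge0 ?sqr_ge0// integ_abs_ge0.
  have xQ : enorm (x t) ^+ 2 <= Q.
    apply: le_trans G _; apply: (@le_trans _ _ (expR (integ (fun s => `|alpha s|) r t) *
      (enorm x0 ^+ 2 + integ (fun s => `|beta s|) r T))).
      by rewrite ler_pM2l ?expR_gt0// lerD2l.
    by rewrite /Q ler_wpM2r.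
  have := enorm_ge0 (x t); move: xQ; rewrite /rho; move: (enorm (x t)) (Q) => e q.
  by nra.
exists x, (fun s => g s (x s)); split => // t rt tT.
by rewrite /g phiE ?scale1r// xrho.
Qed.

Lemma trajectoryS r (x0 : V) T T' x h : T' <= T ->
  trajectory f r x0 T x h -> trajectory f r x0 T' x h.
Proof.
by move=> TT [cx lh E hE]; split => // t rt tT; apply: hE => //; exact: le_trans TT.
Qed.

(** A crude radius, uniform over the starting ball and over [[r, T]], inside which the local
    Lipschitz estimate can be applied. *)
Lemma trajectory_bound (d : R) r T : exists rho, forall x0 x h, enorm x0 <= d ->
  trajectory f r x0 T x h -> forall t, r <= t -> t <= T -> enorm (x t) <= rho.
Proof.
pose A := expR (integ (fun s => `|alpha s|) r T).
pose Q := A * d ^+ 2 + A * (A * integ (fun s => `|beta s|) r T).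
have laa := locint_abs la; have lba := locint_abs lb.
exists (Q + 1) => x0 x h x0d tx t rt tT.
have ab s : s <= T -> `|integ alpha r s| <= integ (fun s => `|alpha s|) r T.
  move=> sT; apply: le_trans (integ_abs _ _ la) _.
  by apply: ae_integ_widen => //; exact: aeW.
have B : integ (fun s => beta s * expR (- integ alpha r s)) r t
        <= A * integ (fun s => `|beta s|) r T.
  apply: (@le_trans _ _ (integ (fun s => A * `|beta s|) r t)).
    apply: le_integ; first by apply: locintM_continuous => //; exact: continuous_expR_integ.
      exact: locintZ.
    move=> s rs st; rewrite mulrC; apply: (@le_trans _ _ (expR (- integ alpha r s) * `|beta s|)).
      by rewrite ler_pM2l ?expR_gt0// ler_norm.
    rewrite ler_wpM2r// ler_expR.
    by have := ab s (le_trans st tT); rewrite ler_norml; lra.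
  rewrite integZ// ler_pM2l ?expR_gt0//.
  by apply: ae_integ_widen => //; exact: aeW.
have E : expR (integ alpha r t) <= A.
  by rewrite ler_expR; have := ab t tT; rewrite ler_norml; lra.
have d2 : enorm x0 ^+ 2 <= d ^+ 2.
  by rewrite ler_sqr ?nnegrE ?enorm_ge0// (le_trans (enorm_ge0 _) x0d).
have b0 := integ_abs_ge0 beta r T.
have A0 : 0 <= A by exact: expR_ge0.
have := trajectory_energy rt (trajectoryS tT tx).
have E0 := expR_gt0 (integ alpha r t).
have xQ : expR (integ alpha r t) * enorm x0 ^+ 2 +
   expR (integ alpha r t) * integ (fun s => beta s * expR (- integ alpha r s)) r t <= Q.
  apply: lerD; first by apply: ler_pM; rewrite ?expR_ge0 ?sqr_ge0.
  apply: (@le_trans _ _ (expR (integ alpha r t) * (A * integ (fun s => `|beta s|) r T))).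
    by rewrite ler_pM2l.
  by rewrite ler_wpM2r// mulr_ge0.
move=> /le_trans/(_ xQ); have := enorm_ge0 (x t); move: (enorm (x t)) (Q) => e q.
by nra.
Qed.

Lemma trajectory_unique r (x0 : V) T x y h k : r <= T ->
  trajectory f r x0 T x h -> trajectory f r x0 T y k -> x T = y T.
Proof.
move=> rT tx ty; have [rho Hr] := trajectory_bound (enorm x0) r T.
have [l _ Hl] := trajectory_lipschitz rho.
have := Hl _ _ _ _ _ _ _ _ rT tx ty (fun t rt tT =>
  conj (Hr _ _ _ (lexx _) tx t rt tT) (Hr _ _ _ (lexx _) ty t rt tT)).
rewrite subrr enorm0 expr0n/= mulr0 => H.
apply/eqP; rewrite -subr_eq0; apply/eqP/enorm_eq0/eqP.
by rewrite -sqrf_eq0 eq_le H sqr_ge0.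
Qed.

(** The set from which [Sf] chooses is nonempty, so the default 0 never arises, and uniqueness
    identifies the chosen value. *)
Lemma Sf_trajectory r (x0 : V) T x h t : trajectory f r x0 T x h -> r <= t -> t <= T ->
  Sf f t r x0 = x t.
Proof.
move=> tx rt tT; have {tT}tx := trajectoryS tT tx; rewrite /Sf.
have P : [set y | exists x, is_solution f r x0 t x /\ x t = y] (x t).
  by exists x; split => //; exact: trajectory_solution tx.
have [y [/solution_trajectory[z [k [tz <-//]]] <-]] := xgetI 0 P.
exact: trajectory_unique rt tz tx.
Qed.

Lemma Sf_cocycle r s t (x0 : V) : r <= s -> s <= t -> Sf f t s (Sf f s r x0) = Sf f t r x0.
Proof.
move=> rs st; have rt := le_trans rs st; have [x [h tx]] := trajectory_exists x0 rt.
rewrite (Sf_trajectory tx rs st) (Sf_trajectory tx rt (lexx t)).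
case: (tx) => cx lh E hE.
(* The restarted trajectory must be constant before [s], so it is integrated anew from [s]; it
   agrees with [x] afterwards. *)
pose x' (u : R) : V := \row_i (x s 0 i + integ (fun s => h s 0 i) s u).
have xx u : s <= u -> x' u = x u.
  move=> su; apply/rowP => i.
  by rewrite mxE !E (integ_chasles (lh i) rs su) addrA.
have tx' : trajectory f s (x s) t x' h.
  split => //.
  - move=> i u; under eq_fun do rewrite mxE.
    by apply: cvgD; [exact: cvg_cst|exact: integ_continuous].
  - by move=> u i; rewrite mxE.
  - by move=> u su ut; rewrite xx// hE// (le_trans rs).
by rewrite (Sf_trajectory tx')// xx.
Qed.

Lemma Sf_lipschitz r t (d : R) : r <= t -> exists2 L : R, 0 <= L & forall x y : V,
  enorm x <= d -> enorm y <= d -> enorm (Sf f t r x - Sf f t r y) <= L * enorm (x - y).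
Proof.
move=> rt; have [rho Hr] := trajectory_bound d r t.
have [l _ Hl] := trajectory_lipschitz rho.
exists (Num.sqrt (expR (integ l r t))); first exact: sqrtr_ge0.
move=> x0 y0 xd yd; have [x [h tx]] := trajectory_exists x0 rt.
have [y [k ty]] := trajectory_exists y0 rt.
rewrite (Sf_trajectory tx)// (Sf_trajectory ty)//.
rewrite -ler_sqr ?nnegrE ?mulr_ge0 ?enorm_ge0 ?sqrtr_ge0// exprMn (sqr_sqrtr (expR_ge0 _)).
by apply: (Hl _ _ _ _ _ _ _ _ rt tx ty) => u ru ut; split; [exact: Hr tx _ _ _|exact: Hr ty _ _ _].
Qed.

Lemma Sf_energy r t (x0 : V) : r <= t ->
  enorm (Sf f t r x0) ^+ 2 <= expR (integ alpha r t) * enorm x0 ^+ 2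
    + expR (integ alpha r t) * integ (fun s => beta s * expR (- integ alpha r s)) r t.
Proof.
move=> rt; have [x [h tx]] := trajectory_exists x0 rt.
by rewrite (Sf_trajectory tx)//; exact: trajectory_energy rt tx.
Qed.

(** * Exponential decay and a uniform absorbing ball *)

Variables (a1 K : R).
Hypotheses (a10 : 0 < a1) (K1 : 1 <= K).
Hypothesis alphaK : forall s t : R, s <= t -> t <= 0 ->
  expR (integ alpha s t) <= K * expR (- a1 * (t - s)).
Variable M : R.
Hypothesis betaM : forall t, integ beta (t - 1) t <= M.

(** For [tau >= 0], the part of the integral over positive times is at most [I], and the factor
    [expR (a1 * tau)] makes up for the decay not guaranteed on [[0, tau]]. *)
Lemma expR_integ_le tau : exists2 K' : R, 0 < K' & forall s t, s <= t -> t <= tau ->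
  expR (integ alpha s t) <= K' * expR (- a1 * (t - s)).
Proof.
wlog tau0 : tau / 0 <= tau.
  move=> H; have [|K' K0 H'] := H (Num.max 0 tau); first by rewrite le_max lexx.
  by exists K' => // s t st tt; apply: H' => //; rewrite le_max tt orbT.
pose I := integ (fun s => `|alpha s|) 0 tau.
have I0 : 0 <= I by exact: integ_abs_ge0.
have Ile s t : 0 <= s -> t <= tau -> integ alpha s t <= I.
  move=> s0 tt; apply: le_trans (ler_norm _) (le_trans (integ_abs _ _ la) _).
  by apply: ae_integ_widen => //; [exact: locint_abs|exact: aeW].
have Kp : 0 < K by exact: lt_le_trans ltr01 K1.
exists (K * expR (I + a1 * tau)); first by rewrite mulr_gt0// expR_gt0.
move=> s t st tt; rewrite -mulrA -expRD.
have [t0|t0] := leP t 0.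
  apply: le_trans (alphaK st t0) _; rewrite ler_pM2l// ler_expR.
  by have := mulr_ge0 (ltW a10) tau0; lra.
have at_ : a1 * t <= a1 * tau by rewrite ler_pM2l.
have [s0|s0] := leP s 0.
  rewrite (integ_chasles la s0 (ltW t0)) expRD.
  apply: (@le_trans _ _ (K * expR (- a1 * (0 - s)) * expR I)).
    by apply: ler_pM; rewrite ?expR_ge0// ?alphaK// ler_expR Ile.
  by rewrite -mulrA -expRD ler_pM2l// ler_expR; lra.
apply: (@le_trans _ _ (expR I)); first by rewrite ler_expR Ile// ltW.
rewrite -[leLHS]mul1r; apply: ler_pM; rewrite ?expR_ge0// ler_expR.
by have := mulr_gt0 a10 s0; lra.
Qed.

Let q := expR (- a1).
Let q01 : 0 < q < 1.
Proof. by rewrite expR_gt0/= -[ltRHS]expR0 ltr_expR oppr_lt0. Qed.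
Let M0 : 0 <= M.
Proof. exact: le_trans (ae_integ_ge0 _ _ lb beta0) (betaM 0). Qed.

(** Induction on the number of unit steps from [t] back to [r]: the last unit window adds at most
    [M], the rest is [q] times the same integral ended at [t - 1], and [M / (1 - q)] is the fixed
    point of [x = q * x + M]. *)
Lemma weighted_beta_le r t :
  integ (fun s => beta s * expR (- a1 * (t - s))) r t <= M / (1 - q).
Proof.
have /andP[q0 q1] := q01.
have cE u : continuous (fun s => expR (- a1 * (u - s))).
  move=> s; apply: continuous_comp; last exact: continuous_expR.
  by apply: cvgM; [exact: cvg_cst|apply: cvgB; [exact: cvg_cst|exact: cvg_id]].
have lE u : locint (fun s => beta s * expR (- a1 * (u - s))) by exact: locintM_continuous.
have MM : M <= M / (1 - q) by rewrite ler_pdivlMr ?subr_gt0// ler_piMr// gerBl ltW.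
have P u v w : w - 1 <= u -> v <= w ->
    integ (fun s => beta s * expR (- a1 * (w - s))) u v <= M.
  move=> wu vw; apply: (@le_trans _ _ (integ beta u v)).
    apply: ae_le_integ => //; apply: ae_imply beta0 => s b0 us sv.
    rewrite ler_piMr// -[leRHS]expR0 ler_expR mulNr oppr_le0 mulr_ge0 ?(ltW a10)//.
    by rewrite subr_ge0 (le_trans sv).
  apply: le_trans (betaM w); exact: ae_integ_widen.
suff H n : forall t, t - n%:R <= r ->
    integ (fun s => beta s * expR (- a1 * (t - s))) r t <= M / (1 - q).
  apply: (H (Num.trunc `|t - r|).+1).
  have := truncnS_gt `|t - r|; have := ler_norm (t - r); move: (_%:R) => p; lra.
elim: n => [|n IH] {}t nt.
  by apply: le_trans MM; apply: P => //; lra.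
have [tr|rt] := leP (t - 1) r; first by apply: le_trans MM; exact: P.
have t1 : t - 1 <= t by lra.
rewrite (integ_chasles (lE t) (ltW rt) t1).
have E : integ (fun s => beta s * expR (- a1 * (t - s))) r (t - 1) =
    q * integ (fun s => beta s * expR (- a1 * (t - 1 - s))) r (t - 1).
  rewrite -integZ//; apply: eq_integ => s _ _.
  by rewrite mulrCA -expRD; congr (_ * expR _); ring.
have {}IH := IH (t - 1) _.
have H1 : integ (fun s => beta s * expR (- a1 * (t - 1 - s))) r (t - 1) <= M / (1 - q).
  by apply: IH; move: nt; rewrite -natr1; lra.
have H2 := P _ _ t (lexx _) (lexx t).
rewrite E; have -> : M / (1 - q) = q * (M / (1 - q)) + M by field; lra.
by apply: lerD => //; rewrite ler_pM2l.
Qed.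

Lemma Sf_absorbing tau : exists rho : R, forall d : R, exists2 T : R, 0 < T &
  forall t s (x : V), t <= tau -> T <= s -> enorm x <= d -> enorm (Sf f t (t - s) x) <= rho.
Proof.
have [K' K'0 HK] := expR_integ_le tau.
have /andP[q0 q1] := q01.
have C0 : 0 <= K' * (M / (1 - q)) by rewrite mulr_ge0 ?divr_ge0 ?subr_ge0 ?(ltW q1) ?(ltW K'0).
(* The squared norm will be at most [1 + c] with [c = K' * (M / (1 - q))], and [e ^+ 2 <= 1 + c]
   implies [e <= 2 + c]. *)
exists (2 + K' * (M / (1 - q))) => d.
(* From this time on [a1 * s] exceeds [K' * d ^+ 2], hence so does [expR (a1 * s)], and the initial
   datum contributes at most 1. *)
exists (K' * d ^+ 2 / a1 + 1).
  by rewrite ltr_wpDl// divr_ge0 ?(ltW a10)// mulr_ge0 ?(ltW K'0)// sqr_ge0.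
move=> t s x tt Ts xd.
have s0 : 0 <= s.
  by apply: le_trans Ts; rewrite addr_ge0// divr_ge0 ?(ltW a10)// mulr_ge0 ?(ltW K'0)// sqr_ge0.
have st : t - s <= t by rewrite gerBl.
have := Sf_energy x st.
have E1 : expR (integ alpha (t - s) t) * enorm x ^+ 2 <= 1.
  apply: (@le_trans _ _ (K' * expR (- a1 * s) * d ^+ 2)).
    apply: ler_pM; rewrite ?expR_ge0 ?sqr_ge0//.
      by apply: le_trans (HK _ _ st tt) _; rewrite opprB addrC subrK.
    by rewrite ler_sqr ?nnegrE ?enorm_ge0// (le_trans (enorm_ge0 _) xd).
  have L : K' * d ^+ 2 <= expR (a1 * s).
    apply: le_trans (expR_ge1Dx _).
    have : K' * d ^+ 2 / a1 * a1 <= (s - 1) * a1 by rewrite ler_pM2r//; lra.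
    by rewrite divfK ?gt_eqF// => H; apply: le_trans H _; have := a10; lra.
  rewrite mulrAC mulNr expRN ler_pdivrMr ?expR_gt0// mul1r; exact: L.
have E2 : expR (integ alpha (t - s) t) *
   integ (fun u => beta u * expR (- integ alpha (t - s) u)) (t - s) t <= K' * (M / (1 - q)).
  have lw : locint (fun u => beta u * expR (- integ alpha (t - s) u)).
    by apply: locintM_continuous => //; exact: continuous_expR_integ.
  apply: (@le_trans _ _ (K' * integ (fun u => beta u * expR (- a1 * (t - u))) (t - s) t)); last first.
    by rewrite ler_pM2l// weighted_beta_le.
  have cE : continuous (fun u => expR (- a1 * (t - u))).
    move=> u; apply: continuous_comp; last exact: continuous_expR.
    by apply: cvgM; [exact: cvg_cst|apply: cvgB; [exact: cvg_cst|exact: cvg_id]].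
  have lE := locintM_continuous lb cE.
  rewrite -!integZ//; apply: ae_le_integ; [exact: locintZ..|].
  apply: ae_imply beta0 => u b0 su ut.
  (* The two exponentials combine into that of the integral of [alpha] over [[u, t]], to which the
     decay bound applies. *)
  rewrite mulrCA [leRHS]mulrCA ler_wpM2l// -expRD.
  rewrite (integ_chasles la su ut) addrAC subrr add0r.
  exact: HK.
move=> /le_trans/(_ (lerD E1 E2)); have := enorm_ge0 (Sf f t (t - s) x).
move: (enorm _) C0 => e; move: (K' * _) => c; nra.
Qed.

End Dissipative.

(** * Pullback attractors of dissipative processes *)

Section Attractor.
Context {R : realType} {N : nat}.
Local Notation V := 'rV[R]_N.
Variable S : R -> R -> V -> V.
Hypothesis Scoc : forall r s t x, r <= s -> s <= t -> S t s (S s r x) = S t r x.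
Hypothesis Slip : forall r t d : R, r <= t -> exists2 L : R, 0 <= L & forall x y : V,
  enorm x <= d -> enorm y <= d -> enorm (S t r x - S t r y) <= L * enorm (x - y).
Hypothesis Sabs : forall tau : R, exists rho : R, forall d : R, exists2 T : R, 0 < T &
  forall t s (x : V), t <= tau -> T <= s -> enorm x <= d -> enorm (S t (t - s) x) <= rho.

(** The absolute value ensures that the ball [B t] contains 0. *)
Let rho (t : R) : R := `|sval (cid (Sabs t))|.
Let B (t : R) : set V := [set x | enorm x <= rho t].

Let Bbdd t : bdd_set (B t). Proof. by exists (rho t). Qed.

Let absorb tau (D : set V) : bdd_set D -> exists2 T : R, 0 < T &
  forall t s x, t <= tau -> s <= t - T -> D x -> B tau (S t s x).
Proof.
move=> [d Dd]; have [T T0 HT] := svalP (cid (Sabs tau)) d; exists T => // t s x tt sT Dx.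
have := HT t (t - s) x tt _ (Dd _ Dx); rewrite subKr => H.
by apply: le_trans (H _) (ler_norm _); lra.
Qed.

Lemma process_strongly_pbd tau : strongly_pbd S tau.
Proof.
have H (t0 : R) (D : set V) : bdd_set D -> exists T : R, 0 < T /\
    forall t s, t <= t0 -> T <= s -> S t (t - s) @` D `<=` B t0.
  move=> bD; have [T T0 HT] := absorb t0 bD; exists T; split => //.
  move=> t s tt Ts _ [x Dx <-]; apply: HT => //; lra.
exists B; split; last exact: H.
split=> [t|t D bD].
  by split; [exists 0; rewrite /B/= enorm0 normr_ge0|exact: Bbdd].
by have [T [T0 HT]] := H t D bD; exists T; split => // s; exact: HT.
Qed.

Definition omega_limit (D : set V) (t : R) : set V := [set y | forall sigma e : R, 0 < e ->
  exists s x, [/\ s <= sigma, D x & enorm (S t s x - y) < e]].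

Lemma omega_limit_sub_ball D t tau : bdd_set D -> t <= tau -> omega_limit D t `<=` B tau.
Proof.
move=> bD tt y oy; have [T T0 HT] := absorb tau bD.
rewrite /B/=; apply/ler_addgt0Pr => e e0.
have [s [x [st Dx sy]]] := oy (t - T) e e0.
have := HT t s x tt st Dx; rewrite /B/=.
by have := enormD (y - S t s x) (S t s x); rewrite subrK enormBC; lra.
Qed.

(** Strong absorption enters here: at an intermediate time [sig <= t], as early as desired, the
    orbit already lies in [B t], so it can be restarted there. *)
Lemma omega_limit_sub D t : bdd_set D -> omega_limit D t `<=` omega_limit (B t) t.
Proof.
move=> bD y oy sigma e e0; have [T T0 HT] := absorb t bD.
pose sig := Num.min sigma t.
have st : sig <= t by rewrite ge_min lexx orbT.
have [s [x [ss Dx sy]]] := oy (sig - T) e e0.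
exists sig, (S sig s x); split.
- by rewrite ge_min lexx.
- exact: HT.
- by rewrite Scoc//; lra.
Qed.

Lemma closed_omega_limit D t : closed (omega_limit D t).
Proof.
apply/closed_enormP => y H sigma e e0.
have e20 : 0 < e / 2 by rewrite divr_gt0.
have [z oz yz] := H _ e20; have [s [x [ss Dx sz]]] := oz sigma _ e20.
exists s, x; split => //.
by have := enormB_le (S t s x) z y; rewrite (enormBC z y); lra.
Qed.

Lemma hsdist_le (X Y : set V) (e : R) :
  (forall x, X x -> exists2 y, Y y & enorm (x - y) <= e) -> (hsdist X Y <= e%:E)%E.
Proof.
move=> H; apply: ge_ereal_sup => _ [x Xx <-]; have [y Yy xy] := H x Xx.
by apply: ge_ereal_inf; exists (enorm (x - y))%:E; [exists y|rewrite lee_fin].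
Qed.

Lemma hsdist_lt (X Y : set V) (e : R) x :
  (hsdist X Y < e%:E)%E -> X x -> exists2 y, Y y & enorm (x - y) < e.
Proof.
move=> H Xx.
have : (ereal_inf [set (enorm (x - y))%:E | y in Y] < e%:E)%E.
  by apply: le_lt_trans H; apply: ereal_sup_ubound; exists x.
by move=> /ereal_inf_lt[_ [y Yy <-]]; rewrite lte_fin; exists y.
Qed.

Let A t := omega_limit (B t) t.

(** Otherwise states started arbitrarily early from [D] remain farther than [e] from [A t]; they lie
    in a ball, and a cluster point of them belongs to [A t]. *)
Lemma omega_limit_attracts : pullback_attracts S A.
Proof.
move=> t D bD e e0; apply: contrapT => H; have [T T0 HT] := absorb t bD.
pose P (sig : R) := [set z | exists s x, [/\ s <= Num.min sig (t - T), D x, z = S t s x &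
  forall y, A t y -> e < enorm (z - y)]].
have [|sig|sig|w Hw] := @enorm_cluster R N (rho t) P.
- move=> s1 s2 s12 z [s [x [ss Dx zE Hz]]]; exists s, x; split => //.
  by move: ss; rewrite !le_min => /andP[ss ->]; rewrite andbT (le_trans ss).
- apply: contrapT => nP; apply: H; exists (Num.min sig (t - T)) => s ss.
  apply: hsdist_le => _ [x Dx <-]; apply: contrapT => nx.
  apply: nP; exists (S t s x), s, x; split => // y Ay.
  by rewrite ltNge; apply/negP => ey; apply: nx; exists y.
- move=> _ [s [x [ss Dx -> _]]]; apply: HT => //.
  by move: ss; rewrite le_min => /andP[].
have Aw : A t w.
  apply: (omega_limit_sub bD) => sigma d d0.
  have [_ [s [x [ss Dx -> _]]] ws] := Hw sigma d d0.
  exists s, x; split => //; last by rewrite enormBC.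
  by move: ss; rewrite le_min => /andP[].
have [z [s [x [_ _ _ Hz]]] wz] := Hw 0 e e0.
by have := Hz w Aw; rewrite enormBC; lra.
Qed.

(** A point of [A t] is a limit of states started in the bounded set [B t], and these come
    arbitrarily close to the closed set [C t]. *)
Lemma omega_limit_minimal (C : R -> set V) : (forall t, closed (C t)) ->
  pullback_attracts S C -> forall t, A t `<=` C t.
Proof.
move=> cC aC t y Ay; apply: (closed_enormP (C t)).1 => // e e0.
have e40 : 0 < e / 4 by rewrite divr_gt0.
have e20 : 0 < e / 2 by rewrite divr_gt0.
have [s0 Hs0] := aC t (B t) (Bbdd t) _ e40.
have [s [x [ss Bx sy]]] := Ay s0 _ e20.
have lt : (hsdist (S t s @` B t) (C t) < (e / 2)%:E)%E.
  by apply: le_lt_trans (Hs0 s ss) _; rewrite lte_fin; lra.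
have [c Cc xc] := hsdist_lt lt (ex_intro2 _ _ x Bx erefl).
exists c => //; have := enormB_le y (S t s x) c.
by rewrite (enormBC y (S t s x)); lra.
Qed.

Let cont s t y (e : R) : s <= t -> 0 < e -> exists2 d : R, 0 < d &
  forall z, enorm (z - y) < d -> enorm (S t s z - S t s y) < e.
Proof.
move=> st e0; have [L L0 HL] := Slip (enorm y + 1) st.
have L1 : 0 < L + 1 by lra.
exists (Num.min 1 (e / (L + 1))); first by rewrite lt_min ltr01 divr_gt0.
move=> z; rewrite lt_min => /andP[z1 ze].
have zd : enorm z <= enorm y + 1 by have := enormD (z - y) y; rewrite subrK; lra.
have yd : enorm y <= enorm y + 1 by lra.
apply: le_lt_trans (HL z y zd yd) _.
move: ze; rewrite ltr_pdivlMr//; have := enorm_ge0 (z - y).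
by move: (enorm (z - y)) => q; nra.
Qed.

(** One inclusion is continuity of [S t s] and the cocycle law. For the other, take orbits whose
    values at [t] approach [y]: their values at [s] cluster at some [w] in [A s], and continuity
    gives [S t s w = y]. *)
Lemma omega_limit_invariant t s : s <= t -> S t s @` A s = A t.
Proof.
move=> st; apply/seteqP; split => [_ [y Ay <-]|y Ay].
  apply: (omega_limit_sub (Bbdd s)) => sigma e e0.
  have [d d0 Hd] := cont y st e0.
  have [u [x [us Bx uy]]] := Ay (Num.min sigma s) d d0.
  move: us; rewrite le_min => /andP[us1 us2].
  exists u, x; split => //.
  by rewrite -(Scoc x us2 st); exact: Hd.
have [T T0 HT] := absorb s (Bbdd t).
(* The tolerance [expR sig] tends to 0 as [sig] tends to minus infinity, so one parameter drives
   both the starting time and the error. *)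
pose P (sig : R) := [set z | exists u x, [/\ u <= Num.min sig (s - T), B t x, z = S s u x &
  enorm (S t u x - y) < expR sig]].
have [|sig|sig|w Hw] := @enorm_cluster R N (rho s) P.
- move=> s1 s2 s12 z [u [x [us Bx zE Hz]]]; exists u, x; split => //.
    by move: us; rewrite !le_min => /andP[us ->]; rewrite andbT (le_trans us).
  by apply: lt_le_trans Hz _; rewrite ler_expR.
- have [u [x [us Bx uy]]] := Ay (Num.min sig (s - T)) _ (expR_gt0 sig).
  by exists (S s u x), u, x.
- move=> _ [u [x [us Bx -> _]]]; apply: HT => //.
  by move: us; rewrite le_min => /andP[].
exists w.
  apply: (omega_limit_sub (Bbdd t)) => sigma d d0.
  have [_ [u [x [us Bx -> _]]] ws] := Hw sigma d d0.
  exists u, x; split => //; last by rewrite enormBC.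
  by move: us; rewrite le_min => /andP[].
apply/eqP; rewrite -subr_eq0; apply/eqP/enorm_eq0/eqP; rewrite eq_le enorm_ge0 andbT.
apply/ler_addgt0Pr => e e0; rewrite add0r.
have e20 : 0 < e / 2 by rewrite divr_gt0.
have [d d0 Hd] := cont w st e20.
have [z [u [x [us Bx zE uy]]] wz] := Hw (ln (e / 2)) d d0.
rewrite lnK ?posrE// in uy.
have us' : u <= s by move: us; rewrite le_min => /andP[_]; lra.
rewrite enormBC in wz; have := Hd z wz; rewrite zE Scoc// => Hz.
have := enormB_le (S t s w) (S t u x) y; rewrite (enormBC (S t s w) (S t u x)); lra.
Qed.

Lemma process_pullback_attractor : exists A : R -> set V, pullback_attractor S A /\
  forall tau, bdd_set (\bigcup_(t in [set t | t <= tau]) A t).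
Proof.
exists A; split; last first.
  move=> tau; exists (rho tau) => y [t tt Ay].
  exact: (omega_limit_sub_ball (Bbdd t) tt Ay).
split.
  move=> t; apply: subclosed_compact (@closed_omega_limit _ _) (@compact_enorm_ball _ _ (rho t)) _.
  exact: omega_limit_sub_ball.
split; first by move=> t s; exact: omega_limit_invariant.
by split; [exact: omega_limit_attracts|exact: omega_limit_minimal].
Qed.

End Attractor.

(** * Sections of null sets *)

Section NullSets.
Context {R : realType}.
Local Notation mu := (@lebesgue_measure R).

Lemma indic_itvcc (c d : R) :
  (fun z : R => (c <= z <= d)%R%:R : R) = \1_(`[c, d]%classic : set R).
Proof.
apply/funext => z; rewrite indicE; congr ((nat_of_bool _)%:R).
by apply/idP/idP => [h|/set_mem]; [apply/mem_set|]; rewrite /= in_itv.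
Qed.

Lemma measurable_series_itv (C c d : nat -> R) : (forall n, 0 <= C n) ->
  measurable_fun setT (fun z : R => \sum_(n <oo) (C n * (c n <= z <= d n)%R%:R)%:E)%E.
Proof.
move=> C0; apply: ge0_emeasurable_sum => [n z _ _|n _].
  by rewrite lee_fin mulr_ge0.
apply/measurable_EFinP; apply: measurable_funM => //.
by rewrite indic_itvcc; exact: measurable_indic.
Qed.

(** The nonnegative series is integrated over [D] term by term, and each indicator integrates to at
    most the length of its interval. *)
Lemma integral_series_itv (D : set R) (C c d : nat -> R) (v : R) : measurable D ->
  (forall n, 0 <= C n) -> 0 <= v ->
  (forall z, D z -> (v%:E <= \sum_(n <oo) (C n * (c n <= z <= d n)%R%:R)%:E)%E) ->
  (v%:E * mu D <= \sum_(n <oo) (C n * Num.max 0 (d n - c n))%:E)%E.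
Proof.
move=> mD C0 v0 H.
have mi n : measurable_fun D (fun z : R => (C n * (c n <= z <= d n)%R%:R)%:E).
  apply/measurable_EFinP; apply: measurable_funM => //.
  by rewrite indic_itvcc; exact: measurable_indic.
rewrite -integral_cst//.
apply: (@le_trans _ _ (\int[mu]_(z in D) \sum_(n <oo) (C n * (c n <= z <= d n)%R%:R)%:E)%E).
  apply: ge0_le_integral => //.
  by apply: measurable_funTS; exact: measurable_series_itv.
rewrite integral_nneseries//; last by move=> n z _; rewrite lee_fin mulr_ge0.
apply: lee_nneseries => n _.
  by move=> _; apply: integral_ge0 => z _; rewrite lee_fin mulr_ge0.
under eq_integral do rewrite EFinM.
rewrite ge0_integralZl_EFin//; last first.
  by apply/measurable_EFinP; rewrite indic_itvcc; exact: measurable_indic.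
have -> : (\int[mu]_(x in D) ((c n <= x <= d n)%R%:R)%:E = mu (`[c n, d n]%classic `&` D))%E.
  by rewrite -integral_indic// -indic_itvcc.
rewrite EFinM; apply: lee_wpmul2l; first by rewrite lee_fin.
apply: (@le_trans _ _ (mu `[c n, d n]%classic)).
  by apply: le_measure; rewrite ?inE//; exact: measurableI.
rewrite lebesgue_measure_itv/= lte_fin; case: ifPn => [cd|_].
  by rewrite -EFinD lee_fin le_max lexx orbT.
by rewrite lee_fin le_max lexx.
Qed.

Context {N : nat}.
Local Notation V := 'rV[R]_N.

(* Integrate the covering inequality for indicators one coordinate at a time:
   after [k] steps the first [k] indicators have become side lengths. *)
Lemma box_volume_le (p : nat -> bool) (c d : nat -> V) (lo hi : V) :
  (forall i, lo 0 i <= hi 0 i) ->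
  (forall y : V, (forall i, lo 0 i <= y 0 i <= hi 0 i) ->
     exists n, p n /\ forall i, c n 0 i <= y 0 i <= d n 0 i) ->
  ((\prod_(i < N) (hi 0 i - lo 0 i))%:E <=
    \sum_(n <oo) ((p n)%:R * \prod_(i < N) Num.max 0 (d n 0 i - c n 0 i))%:E)%E.
Proof.
move=> lohi cover.
pose G (k : nat) (y : V) (n : nat) (i : 'I_N) : R := if (i < k)%N
  then Num.max 0 (d n 0 i - c n 0 i) else (c n 0 i <= y 0 i <= d n 0 i)%R%:R.
have G0 k y n i : 0 <= G k y n i by rewrite /G; case: ifP => // _; rewrite le_max lexx.
suff P k : (k <= N)%N -> forall y : V, (forall i, lo 0 i <= y 0 i <= hi 0 i) ->
   ((\prod_(i < N | (i < k)%N) (hi 0 i - lo 0 i))%:E <=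
      \sum_(n <oo) ((p n)%:R * \prod_(i < N) G k y n i)%:E)%E.
  have := P N (leqnn N) lo (fun i => introT andP (conj (lexx _) (lohi i))).
  rewrite (eq_bigl xpredT) => [|i]; last by rewrite ltn_ord.
  congr (_ <= _)%E; apply: eq_eseriesr => n _; congr (_ * _)%:E.
  by apply: eq_bigr => i _; rewrite /G ltn_ord.
elim: k => [_ y yb|k IH kN y yb].
  rewrite big1 => [|i]; last by rewrite ltn0.
  have [n [pn Hn]] := cover y yb.
  apply: le_trans (nneseries_lim_ge (m := 0%N) n.+1 _); last first.
    by move=> m _ _; rewrite lee_fin mulr_ge0// prodr_ge0.
  rewrite big_nat_recr//= -[leLHS]add0e; apply: leeD.
    by apply: sume_ge0 => m _; rewrite lee_fin mulr_ge0// prodr_ge0.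
  by rewrite lee_fin pn mul1r big1// => i _; rewrite /G Hn.
pose K : 'I_N := Ordinal kN.
have kK : (K : nat) = k by [].
pose upd z : V := \row_i if i == K then z else y 0 i.
pose C n := (p n)%:R * \prod_(i < N | i != K) G k y n i.
have C0 n : 0 <= C n by rewrite mulr_ge0// prodr_ge0.
have -> : \prod_(i < N | (i < k.+1)%N) (hi 0 i - lo 0 i) =
    \prod_(i < N | (i < k)%N) (hi 0 i - lo 0 i) * (hi 0 K - lo 0 K).
  rewrite (bigD1 K)/= ?kK// mulrC; congr (_ * _); apply: eq_bigl => i.
  by rewrite ltnS -(inj_eq val_inj) /=; case: (ltngtP i k).
have v0 : 0 <= \prod_(i < N | (i < k)%N) (hi 0 i - lo 0 i).
  by apply: prodr_ge0 => i _; rewrite subr_ge0.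
have := @integral_series_itv `[lo 0 K, hi 0 K]%classic C (fun n => c n 0 K)
  (fun n => d n 0 K) _ (measurable_itv _) C0 v0.
have -> : mu `[lo 0%R K, hi 0%R K]%classic = (hi 0%R K - lo 0%R K)%:E.
  rewrite lebesgue_measure_itv/= lte_fin; case: ifPn => [//|]; rewrite -leNgt => hl.
  by rewrite (_ : hi 0 K = lo 0 K) ?subrr//; apply/eqP; rewrite eq_le hl lohi.
rewrite -EFinM => H.
apply: le_trans (H _) _ => [z|].
  rewrite /= in_itv/= => zb.
  have ub i : lo 0 i <= upd z 0 i <= hi 0 i.
    by rewrite mxE; case: eqP => [->|_].
  apply: le_trans (IH (ltnW kN) _ ub) _; rewrite le_eqVlt; apply/orP; left; apply/eqP.
  apply: eq_eseriesr => n _; congr EFin.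
  rewrite (bigD1 K)//= /C [G k _ n K]/G kK ltnn mxE eqxx mulrCA mulrC; congr (_ * _).
  congr (_ * _); apply: eq_bigr => i iK; rewrite /G mxE (negbTE iK).
  by [].
apply: lee_nneseries => [n _ _|n _].
  by rewrite lee_fin mulr_ge0// le_max lexx.
rewrite lee_fin /C [in leRHS](bigD1 K)//= [G k.+1 _ n K]/G kK ltnSn.
rewrite mulrCA mulrC le_eqVlt; apply/orP; left; apply/eqP; congr (_ * _); congr (_ * _).
apply: eq_bigr => i iK; rewrite /G.
rewrite ltnS (leq_eqVlt i k); move: iK; rewrite -(inj_eq val_inj) /= => /negbTE.
by move=> ->.
Qed.

(** Markov's inequality. Cover [Z] by boxes of total volume below [v * e]. For [t] in [TQ], the
    boxes met at time [t] cover the fixed box, so their cross-sections have total volume at least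
    [v]; the set [E] of all such times is measurable and has measure at most [e]. *)
Lemma null_section (Z : set (R * V)) (lo hi : V) : null_RxV Z ->
  (forall i, lo 0 i < hi 0 i) ->
  mu.-negligible [set t | forall y : V, (forall i, lo 0 i <= y 0 i <= hi 0 i) -> Z (t, y)].
Proof.
move=> nZ lohi; set TQ := (X in mu.-negligible X).
pose v := \prod_(i < N) (hi 0 i - lo 0 i).
have v0 : 0 < v by apply: prodr_gt0 => i _; rewrite subr_gt0.
have key (e : R) : 0 < e -> exists E, [/\ measurable E, TQ `<=` E & (mu E <= e%:E)%E].
  move=> e0; have [a [b [c [d [cov vol]]]]] := nZ _ (mulr_gt0 v0 e0).
  pose W n := \prod_(i < N) Num.max 0 (d n 0 i - c n 0 i).
  have W0 n : 0 <= W n by apply: prodr_ge0 => i _; rewrite le_max lexx.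
  pose g (t : R) := (\sum_(n <oo) (W n * (a n <= t <= b n)%R%:R)%:E)%E.
  pose E := [set t : R | (v%:E <= g t)%E].
  have mE : measurable E.
    have := emeasurable_fun_c_infty measurableT (measurable_series_itv a b W0) v%:E.
    by rewrite setTI.
  exists E; split => //.
    move=> t Tt; rewrite /E /= /g.
    under eq_eseriesr do rewrite mulrC.
    apply: (@box_volume_le (fun n => a n <= t <= b n)) => [i|y yb]; first exact: ltW.
    by have [n _ [/= tn yn]] := cov _ (Tt y yb); exists n.
  have := @integral_series_itv E W a b v mE W0 (ltW v0) (fun t => id).
  have S : (\sum_(n <oo) (W n * Num.max 0 (b n - a n))%:E <= (v * e)%:E)%E.
    apply: lime_le.
      by apply: is_cvg_nneseries => n _ _; rewrite lee_fin mulr_ge0// le_max lexx.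
    apply: nearW => n; rewrite sumEFin lee_fin big_mkord; apply/ltW.
    apply: le_lt_trans (vol n); rewrite le_eqVlt; apply/orP; left; apply/eqP.
    by apply: eq_bigr => i _; rewrite /boxvol mulrC.
  move=> /le_trans/(_ S); rewrite EFinM lee_pmul2l//.
have [E HE] := choice (fun n => key n.+1%:R^-1 (etrans (invr_gt0 _) (ltr0Sn _ n))).
exists (\bigcap_n E n); split.
- by apply: bigcapT_measurable => n; case: (HE n).
- apply/eqP; rewrite eq_le measure_ge0 andbT; apply/lee_addgt0Pr => e e0; rewrite add0e.
  pose n := Num.trunc e^-1.
  have [mE _ Ele] := HE n.
  apply: le_trans (_ : (mu (E n) <= _)%E).
    apply: le_measure; rewrite ?inE//; last exact: bigcap_inf.
    by apply: bigcapT_measurable => k; case: (HE k).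
  apply: le_trans Ele _; rewrite lee_fin invf_ple ?posrE ?ltr0Sn//.
  exact/ltW/truncnS_gt.
- by move=> t Tt n _; case: (HE n) => _ + _; exact.
Qed.

(** If [P t] fails at a point, it fails on one of countably many boxes with rational centres, which
    then lies in the section of [Z] at [t]; each box allows this only for a null set of times. *)
Lemma ae_RxV_forall (P : R -> V -> Prop) : ae_RxV P ->
  {ae mu, forall t, forall x, ~ P t x ->
     exists2 e : R, 0 < e & forall y, enorm (x - y) < e -> ~ P t y} ->
  {ae mu, forall t, forall x, P t x}.
Proof.
move=> [Z [nZ ZP]] open_nP.
pose lo (q : 'rV[rat]_N * nat) : V := \row_i (ratr (q.1 0 i) - q.2.+1%:R^-1).
pose hi (q : 'rV[rat]_N * nat) : V := \row_i (ratr (q.1 0 i) + q.2.+1%:R^-1).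
pose TQ q := [set t | forall y : V, (forall i, lo q 0 i <= y 0 i <= hi q 0 i) -> Z (t, y)].
have nTQ q : mu.-negligible (TQ q).
  apply: null_section => // i; rewrite !mxE.
  by rewrite ltrBlDr -addrA ltrDl addr_gt0 ?invr_gt0 ?ltr0Sn.
pose F n := if unpickle n is Some q then TQ q else set0.
have nF n : mu.-negligible (F n).
  by rewrite /F; case: unpickle => [q|]; [exact: nTQ|exact: negligible_set0].
apply: negligibleS (negligibleU open_nP (negligible_bigcup nF)).
move=> t /= /existsNP[x nPx].
have [Ht|] := pselect (forall x, ~ P t x ->
     exists2 e : R, 0 < e & forall y, enorm (x - y) < e -> ~ P t y); last by left.
right; have [e e0 He] := Ht x nPx.
(* With half-side [del] and a centre within [del] of [x] in each coordinate, points of the box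
   differ from [x] by at most [2 * del] per coordinate, hence by less than [e] in norm. *)
pose k := Num.trunc (2 * (N%:R + 1) / e).
have N1 : 0 < N%:R + 1 :> R by rewrite ltr_wpDl.
pose del : R := k.+1%:R^-1.
have del0 : 0 < del by rewrite invr_gt0 ltr0Sn.
have dele : N%:R * (2 * del) < e.
  have : 2 * (N%:R + 1) / e < k.+1%:R by exact: truncnS_gt.
  rewrite ltr_pdivrMr// => H.
  apply: (@lt_trans _ _ (2 * (N%:R + 1) * del)); first by nra.
  by rewrite /del ltr_pdivrMr ?ltr0Sn// [ltRHS]mulrC.
have [q Hq] : exists q : 'I_N -> rat, forall i, `|x 0 i - ratr (q i)| < del.
  have ex i : exists r : rat, `|x 0 i - ratr r| < del.
    have [|r /=] := @rat_in_itvoo R (x 0 i - del) (x 0 i + del); first by lra.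
    by rewrite in_itv/= => /andP[r1 r2]; exists r; rewrite ltr_norml; lra.
  by exists (fun i => sval (cid (ex i))) => i; exact: svalP (cid (ex i)).
exists (pickle ((\row_i q i : 'rV[rat]_N), k)) => //.
rewrite /F pickleK => y yb; apply: contrapT => nZy; apply: (He y); last exact: ZP.
apply: le_lt_trans dele; apply: enorm_le_coord => i; rewrite !mxE.
have := yb i; rewrite !mxE /= -/del; have := Hq i.
by rewrite ltr_norml ler_norml; lra.
Qed.

End NullSets.

(** * Translation invariance of the integral *)

Lemma lebesgue_measure_translate (R : realType) (t : R) (A : set R) : measurable A ->
  pushforward (@lebesgue_measure R) (fun s : measurableTypeR R => s + t : measurableTypeR R) A =
  lebesgue_measure A.
Proof.
have mt : measurable_fun setT (fun s : measurableTypeR R => s + t : measurableTypeR R).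
  exact: measurable_funD.
move=> mA; apply/esym/lebesgue_measure_unique => //= _ [[a b]] _ <-.
rewrite /pushforward.
have -> : (fun s : R => s + t) @^-1` `]a, b] = `]a - t, b - t]%classic.
  by apply/seteqP; split => s /=; rewrite !in_itv/= ltrBlDr lerBrDr.
rewrite !lebesgue_measure_itv/= !lte_fin ltrD2r; case: ifP => // _.
by rewrite -!EFinD; congr EFin; lra.
Qed.

(** Turns the bound on the translates of [beta] in (H3) into a bound over moving windows. *)
Lemma integ_translate (R : realType) (h : R -> R) (a b t : R) : locint h ->
  \int[@lebesgue_measure R]_(s in `[a, b]) h (s + t) = integ h (a + t) (b + t).
Proof.
move=> lh; rewrite integE /Rintegral; congr fine.
pose phi := fun s : measurableTypeR R => s + t : measurableTypeR R.
have mphi : measurable_fun setT phi by exact: measurable_funD.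
have mh := locint_measurable lh.
have pre : phi @^-1` `[a + t, b + t] = `[a, b]%classic.
  by apply/seteqP; split => s /=; rewrite !in_itv/= !lerD2r.
have mD : measurable (`[a + t, b + t]%classic : set (measurableTypeR R)) by [].
have ih : (@lebesgue_measure R).-integrable (phi @^-1` `[a + t, b + t]) ((EFin \o h) \o phi).
  apply/integrableP; split.
    apply/measurable_EFinP; apply: measurable_funTS.
    exact: (measurableT_comp mh mphi).
  have mah : measurable_fun (`[a + t, b + t]%classic : set (measurableTypeR R))
      (fun y : measurableTypeR R => `|(h y)%:E|%E).
    by apply: measurable_funTS; apply: measurableT_comp => //; exact/measurable_EFinP.
  have := ge0_integral_pushforward mphi (@lebesgue_measure R) mD mah (fun _ _ => abse_ge0 _).
  move=> <-.
  rewrite (eq_measure_integral (@lebesgue_measure R)).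
    by have /integrableP[] := lh (a + t) (b + t).
  by move=> A mA _; exact: lebesgue_measure_translate.
have mEh : measurable_fun [set: measurableTypeR R] (EFin \o h) by exact/measurable_EFinP.
transitivity (\int[pushforward (@lebesgue_measure R) phi]_(y in `[(a + t)%R, (b + t)%R]) (EFin \o h) y)%E.
  by rewrite (integral_pushforward mphi mEh ih mD) pre.
by apply: eq_measure_integral => A mA _; exact: lebesgue_measure_translate.
Qed.

(** Using natural radii, one null set of times serves all balls, so [f t] is locally Lipschitz for
    almost every [t]; a strict failure of the inequality at [x] then persists near [x]. *)
Lemma dissipative_ae_forall (R : realType) (N : nat) (f : R -> 'rV[R]_N -> 'rV[R]_N)
    (alpha beta : R -> R) :
  (forall rho : R, exists m l : R -> R, [/\ locint m, locint l &
    {ae (@lebesgue_measure R), forall t, forall x y, enorm x <= rho -> enorm y <= rho ->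
      enorm (f t x) <= m t /\ enorm (f t x - f t y) <= l t * enorm (x - y)}]) ->
  ae_RxV (fun t x => 2 * dotp (f t x) x <= alpha t * enorm x ^+ 2 + beta t) ->
  {ae (@lebesgue_measure R), forall t, forall x,
     2 * dotp (f t x) x <= alpha t * enorm x ^+ 2 + beta t}.
Proof.
move=> fLip /ae_RxV_forall; apply.
have L (n : nat) : {ae (@lebesgue_measure R), forall t, exists l : R,
    forall x y, enorm x <= n%:R -> enorm y <= n%:R ->
    enorm (f t x - f t y) <= l * enorm (x - y)}.
  have [m [l [_ _ H]]] := fLip n%:R; apply: ae_imply H => t H.
  by exists (l t) => x y xn yn; case: (H x y xn yn).
apply: ae_imply (ae_nat L) => t {}L x /negP; rewrite -ltNge => Px.
have [l Hl] := L (Num.trunc (enorm x + 1)).+1.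
have nx : enorm x + 1 < (Num.trunc (enorm x + 1)).+1%:R by exact: truncnS_gt.
(* [D] is the positive excess at [x], and [A] bounds the rate at which the excess can fall within
   distance 1 of [x]; it therefore stays positive within [D / (A + 1)]. *)
pose X := enorm x; pose A := 2 * (`|l| * (X + 1)) + 2 * enorm (f t x) + `|alpha t| * (2 * X + 1).
pose D := 2 * dotp (f t x) x - (alpha t * X ^+ 2 + beta t).
have X0 : 0 <= X by exact: enorm_ge0.
have A0 : 0 <= A.
  have f0 := enorm_ge0 (f t x); have l0 := normr_ge0 l; have a0 := normr_ge0 (alpha t).
  by rewrite /A !addr_ge0 ?mulr_ge0 ?addr_ge0 ?mulr_ge0.
have D0 : 0 < D by rewrite subr_gt0.
exists (Num.min 1 (D / (A + 1))); first by rewrite lt_min ltr01 divr_gt0//; lra.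
move=> y; rewrite lt_min => /andP[y1]; rewrite ltr_pdivlMr; last by lra.
move=> yD; apply/negP; rewrite -ltNge.
pose w := enorm (x - y).
have w0 : 0 <= w by exact: enorm_ge0.
have yX : enorm y <= X + 1.
  by have := enormD (y - x) x; rewrite subrK enormBC -/X -/w; rewrite -/w in y1; lra.
have fyx : enorm (f t y - f t x) <= `|l| * w.
  apply: (@le_trans _ _ (l * w)); last by rewrite ler_wpM2r// ler_norm.
  by rewrite /w (enormBC x y); apply: Hl; rewrite -/X in nx *; lra.
have T1 : `|dotp (f t y - f t x) y| <= `|l| * w * (X + 1).
  by apply: le_trans (dotp_le _ _) _; apply: ler_pM => //; exact: enorm_ge0.
have T2 : `|dotp (y - x) (f t x)| <= w * enorm (f t x).
  by apply: le_trans (dotp_le _ _) _; rewrite enormBC.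
have T3 : `|alpha t * (enorm y ^+ 2 - X ^+ 2)| <= `|alpha t| * (w * (2 * X + 1)).
  rewrite normrM ler_wpM2l// subr_sqr normrM; apply: ler_pM => //.
    by rewrite /w enormBC; exact: enorm_dist.
  by rewrite ger0_norm ?addr_ge0 ?enorm_ge0//; lra.
have E : dotp (f t y) y = dotp (f t x) x + dotp (f t y - f t x) y + dotp (y - x) (f t x).
  by rewrite !dotpBl (dotpC y) (dotpC x); ring.
move: yD T1 T2 T3; rewrite E -/w /D /A mulrBr.
move: (dotp (f t x) x) (dotp (f t y - _) _) (dotp (y - x) _) (alpha t * enorm y ^+ 2) => d1 d2 d3 ay.
move: (alpha t * X ^+ 2) => ax.
have -> : w * (2 * (`|l| * (X + 1)) + 2 * enorm (f t x) + `|alpha t| * (2 * X + 1) + 1) =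
  2 * (`|l| * w * (X + 1)) + 2 * (w * enorm (f t x)) + `|alpha t| * (w * (2 * X + 1)) + w by ring.
move: (`|l| * w * (X + 1)) (w * enorm (f t x)) (`|alpha t| * (w * (2 * X + 1))) => q1 q2 q3.
by rewrite !ler_norml; lra.
Qed.

(** * Strong dissipativity and the pullback attractor of the solution process *)

Theorem theorem6p3 (R : realType) (N : nat) (f : R -> 'rV[R]_N -> 'rV[R]_N)
    (alpha beta : R -> R) (alpha1 K : R) :
  LC f ->
  (* (H1) *)
  locally_integrable setT alpha -> locally_integrable setT beta ->
  {ae (@lebesgue_measure R), forall t, 0 <= beta t} ->
  ae_RxV (fun t x => 2 * dotp (f t x) x <= alpha t * enorm x ^+ 2 + beta t) ->
  (* (H2) *)
  0 < alpha1 -> 1 <= K ->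
  (forall s t, s <= t -> t <= 0 ->
     expR (\int[lebesgue_measure]_(u in `[s, t]) alpha u)
       <= K * expR (- alpha1 * (t - s))) ->
  (* (H3) *)
  (forall r, 0 < r -> exists M : R, forall t,
     \int[lebesgue_measure]_(s in `[- r, r]) beta (s + t) <= M) ->
  (forall tau, strongly_pbd (Sf f) tau) /\
  exists A : R -> set 'rV[R]_N, pullback_attractor (Sf f) A /\
    forall tau, bdd_set (\bigcup_(t in [set t | t <= tau]) A t).
Proof.
move=> [mf fLC] /locally_integrable_locint la /locally_integrable_locint lb b0 H1 a10 K1 H2 H3.
have fLip (rho : R) : exists m l : R -> R, [/\ locint m, locint l &
    {ae (@lebesgue_measure R), forall t, forall x y, enorm x <= rho -> enorm y <= rho ->
      enorm (f t x) <= m t /\ enorm (f t x - f t y) <= l t * enorm (x - y)}].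
  have [m [l [lm [ll H]]]] := fLC _ (@compact_enorm_ball R N rho).
  by exists m, l; split => //; exact: locally_integrable_locint.
have fdis := dissipative_ae_forall fLip H1.
(* The window of radius 1 about [t] contains [[t - 1, t]], and [beta] is nonnegative almost
   everywhere. *)
have [M HM] := H3 1 ltr01.
have betaM t : integ beta (t - 1) t <= M.
  apply: le_trans (HM t); rewrite integ_translate//.
  by apply: ae_integ_widen => //; lra.
have alphaK (s t : R) : s <= t -> t <= 0 ->
    expR (integ alpha s t) <= K * expR (- alpha1 * (t - s)).
  by rewrite integE; exact: H2.
have coc := Sf_cocycle mf fLip la lb b0 fdis.
have lip := Sf_lipschitz mf fLip la lb b0 fdis.
have abs := Sf_absorbing mf fLip la lb b0 fdis a10 K1 alphaK betaM.
split; first exact: process_strongly_pbd abs.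
exact: process_pullback_attractor coc lip abs.
Qed.
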